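(* Let $F:\mathbb{C}\to\mathbb{C}$ be an entire function, $F\not\equiv 0$, let $a\in\mathbb{C}$ be a node or focus of $\dot{x}=F(x)$, and let $\mathcal{N}$ be the basin of $F$ in $a$. Then $\mathcal{N}$ is simply connected.
   Context: Consider the autonomous planar system $\dot{x}=F(x)$, $x\in\mathbb{C}$, $t\in\mathbb{R}$, with flow $\Phi(t,x)$ on the maximal interval of existence; $\Gamma(x)$ is the (full) orbit through $x$. $w_+(\Gamma)$ (resp. $w_-(\Gamma)$) is the positive (resp. negative) limit set of an orbit $\Gamma$, i.e. the set of all limits in $\mathbb{C}$ along sequences of times tending to the right (resp. left) endpoint of the maximal interval of existence. Equilibria are the zeros of $F$. A node or focus is a simple zero $a$ of $F$ that is attracting (stable) or repelling (unstable), i.e. all orbits through some neighborhood of $a$ tend to $a$ in positive time (attracting) or in negative time (repelling). The basin of $a$ is $\mathcal{N}=\{x\in\mathbb{C}: w_{+}(\Gamma(x))=\{a\}\}$ if $a$ is attracting, and $\mathcal{N}=\{x\in\mathbb{C}: w_{-}(\Gamma(x))=\{a\}\}$ if $a$ is repelling. *)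

(* Defs.v *)
(* Stdlib real numbers with Coquelicot; [C] is Coquelicot's type of complex
   numbers. *)
From Stdlib Require Import Reals.
From Coquelicot Require Import Coquelicot.
Open Scope R_scope.

Definition entire (F : C -> C) : Prop :=
  forall z : C, ex_derive (K := C_AbsRing) (V := C_NormedModule) F z.

Definition open_interval (alpha omega : Rbar) (t : R) : Prop :=
  Rbar_lt alpha t /\ Rbar_lt t omega.

(* The time variable is real, so [phi] is differentiated with [C] seen as a
   normed module over [R]. *)
Definition solution (F : C -> C) (x : C) (alpha omega : Rbar) (phi : R -> C)
    : Prop :=
  open_interval alpha omega 0 /\ phi 0 = x /\
  forall t : R, open_interval alpha omega t ->
    is_derive (K := R_AbsRing) (V := C_R_NormedModule) phi t (F (phi t)).

(* [phi] is [t |-> Phi(t, x)] on the maximal interval of existence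
   [(alpha, omega)]; values of [phi] outside this interval are irrelevant. *)
Definition maximal_solution (F : C -> C) (x : C) (alpha omega : Rbar)
    (phi : R -> C) : Prop :=
  solution F x alpha omega phi /\
  forall (alpha' omega' : Rbar) (psi : R -> C),
    solution F x alpha' omega' psi ->
    Rbar_le alpha alpha' /\ Rbar_le omega' omega.

(* [w_plus F x] and [w_minus F x] are the limit sets of the orbit through
   [x]. *)
Definition w_plus (F : C -> C) (x y : C) : Prop :=
  exists (alpha omega : Rbar) (phi : R -> C),
    maximal_solution F x alpha omega phi /\
    exists t : nat -> R,
      (forall n, open_interval alpha omega (t n)) /\
      is_lim_seq t omega /\
      filterlim (fun n => phi (t n)) eventually (locally y).

Definition w_minus (F : C -> C) (x y : C) : Prop :=
  exists (alpha omega : Rbar) (phi : R -> C),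
    maximal_solution F x alpha omega phi /\
    exists t : nat -> R,
      (forall n, open_interval alpha omega (t n)) /\
      is_lim_seq t alpha /\
      filterlim (fun n => phi (t n)) eventually (locally y).

Definition tends_forward (F : C -> C) (x a : C) : Prop :=
  exists (alpha omega : Rbar) (phi : R -> C),
    maximal_solution F x alpha omega phi /\
    filterlim phi (within (open_interval alpha omega) (Rbar_locally omega))
      (locally a).

Definition tends_backward (F : C -> C) (x a : C) : Prop :=
  exists (alpha omega : Rbar) (phi : R -> C),
    maximal_solution F x alpha omega phi /\
    filterlim phi (within (open_interval alpha omega) (Rbar_locally alpha))
      (locally a).

Definition attracting (F : C -> C) (a : C) : Prop :=
  locally a (fun x => tends_forward F x a).

Definition repelling (F : C -> C) (a : C) : Prop :=
  locally a (fun x => tends_backward F x a).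

Definition simple_zero (F : C -> C) (a : C) : Prop :=
  F a = 0%C /\
  exists l : C,
    is_derive (K := C_AbsRing) (V := C_NormedModule) F a l /\ l <> 0%C.

Definition node_or_focus (F : C -> C) (a : C) : Prop :=
  simple_zero F a /\ (attracting F a \/ repelling F a).

Definition basin (F : C -> C) (a : C) (x : C) : Prop :=
  (attracting F a /\ forall y : C, w_plus F x y <-> y = a) \/
  (repelling F a /\ forall y : C, w_minus F x y <-> y = a).

Definition unit_interval (t : R) : Prop := 0 <= t <= 1.

Definition unit_square (p : R * R) : Prop :=
  unit_interval (fst p) /\ unit_interval (snd p).

Definition path_in (D : C -> Prop) (gamma : R -> C) (x y : C) : Prop :=
  continuous_on unit_interval gamma /\
  (forall t, unit_interval t -> D (gamma t)) /\
  gamma 0 = x /\ gamma 1 = y.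

Definition path_connected (D : C -> Prop) : Prop :=
  forall x y : C, D x -> D y -> exists gamma : R -> C, path_in D gamma x y.

(* Homotopy relative to the base point [gamma 0 = gamma 1]; in [H (s, t)],
   [s] is the homotopy parameter and [t] the parameter of the loop. *)
Definition null_homotopic_in (D : C -> Prop) (gamma : R -> C) : Prop :=
  exists H : R * R -> C,
    continuous_on unit_square H /\
    (forall p, unit_square p -> D (H p)) /\
    (forall t, unit_interval t -> H (0, t) = gamma t) /\
    (forall t, unit_interval t -> H (1, t) = gamma 0) /\
    (forall s, unit_interval s -> H (s, 0) = gamma 0 /\ H (s, 1) = gamma 0).

Definition simply_connected (D : C -> Prop) : Prop :=
  path_connected D /\
  forall (x : C) (gamma : R -> C), path_in D gamma x x ->
    null_homotopic_in D gamma.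

(* Main.v *)
From Stdlib Require Import Reals ZArith Lra Lia Psatz Classical ClassicalEpsilon.
From Coquelicot Require Import Coquelicot.
Require Import Defs.
Open Scope R_scope.

(** The basin of an attracting zero [a] is contracted to [a] by the flow itself.
    If [x] lies in the basin, its trajectory exists for all positive times, stays
    in the basin and tends to [a]; run through in the time [s / (1 - s)],
    [0 <= s < 1], and closed up by [a] at [s = 1], these trajectories form a
    deformation of the basin to the point [a] ([contraction]), and a contractible
    set is simply connected ([contractible_simply_connected]). A repelling zero
    becomes attracting under time reversal, that is, for [- F].

    What has to be shown is that this deformation is continuous. Up to a finite
    time this is continuous dependence on initial values
    ([continuous_dependence]), which follows from Gronwall's inequality once [F]
    is Lipschitz on bounded sets. Uniformity near infinite time comes from
    [trapping]: if [Re F'(a) < 0], the distance to [a] does not increase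
    along trajectories near [a], so a trajectory that is close to [a] at one time
    remains so. Only points of the basin are moved, and these have trajectories by
    definition.

    Both remaining facts, the Lipschitz property and [Re F'(a) < 0], come from
    complex analysis, starting from the mere existence of [F']. The
    theorem of Goursat gives holomorphic functions on half-planes a primitive
    ([half_plane_primitive]). In the coordinate [w] with [z = a + exp w] a
    function near [a] becomes a [2 pi i]-periodic function on a left half-plane,
    and if that function tends to 0 far to the left its primitive is again
    periodic ([periodic_primitive]). For the difference quotient of [F] this
    yields Cauchy's estimate of [F'] ([cauchy_estimate]), hence the Lipschitz
    property. For [F'(a) / K - 1], where [w' = K w] is the equation in this
    coordinate when [F a = 0], it yields a new coordinate [w + J w] in which
    every trajectory has the constant velocity [F'(a)] ([log_rectification]). If [Re F'(a) >= 0], the real part of this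
    coordinate cannot decrease, although it would tend to minus infinity on a
    trajectory tending to [a] ([trajectory_bounded_away]). So an attracting simple
    zero has [Re F'(a) < 0]; in particular no simple zero is both attracting and
    repelling, and the two alternatives in the definition of the basin exclude
    each other. *)

(** * Complex-valued functions: continuity and differential calculus *)

Lemma Cmod_le_sum (z : C) : Cmod z <= Rabs (fst z) + Rabs (snd z).
Proof.
  unfold Cmod. apply Rsqr_incr_0_var.
  - rewrite Rsqr_sqrt by nra. unfold Rsqr.
    rewrite <- (pow2_abs (fst z)), <- (pow2_abs (snd z)).
    pose proof (Rabs_pos (fst z)); pose proof (Rabs_pos (snd z)); nra.
  - pose proof (Rabs_pos (fst z)); pose proof (Rabs_pos (snd z)); lra.
Qed.

Lemma Rabs_fst_le (z : C) : Rabs (fst z) <= Cmod z.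
Proof. eapply Rle_trans; [apply Rmax_l|apply Rmax_Cmod]. Qed.

Lemma Rabs_snd_le (z : C) : Rabs (snd z) <= Cmod z.
Proof. eapply Rle_trans; [apply Rmax_r|apply Rmax_Cmod]. Qed.

Lemma Cmod_sqr (z : C) : Cmod z * Cmod z = fst z * fst z + snd z * snd z.
Proof.
  pose proof (Cmod2_alt z) as H. unfold Re, Im in H. simpl in H. lra.
Qed.

Lemma Cmod_sub_sym (z w : C) : Cmod (z - w) = Cmod (w - z).
Proof. rewrite <- Cmod_opp. f_equal. ring. Qed.

Lemma Cmod_triangle3 (x y z : C) : Cmod (x - z) <= Cmod (x - y) + Cmod (y - z).
Proof. replace (x - z)%C with ((x - y) + (y - z))%C by ring. apply Cmod_triangle. Qed.

Lemma ball_C (z w : C) (e : R) : Cmod (w - z) < e -> ball z e w.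
Proof. apply C_NormedModule_mixin_compat1. Qed.

Lemma ball_C_inv (z w : C) (e : R) : ball z e w -> Cmod (w - z) < 2 * e.
Proof.
  intros [H1 H2].
  eapply Rle_lt_trans; [apply Cmod_le_sum|].
  unfold ball in H1, H2; simpl in H1, H2.
  unfold AbsRing_ball, abs, minus, plus, opp in H1, H2; simpl in *. lra.
Qed.

Lemma filterlim_C {T : Type} (G : (T -> Prop) -> Prop) {FG : Filter G}
    (f : T -> C) (l : C) :
  filterlim f G (locally l) <->
  forall e, 0 < e -> G (fun x => Cmod (f x - l) < e).
Proof.
  rewrite filterlim_locally. split.
  - intros H e He. assert (He' : 0 < e / 2) by lra.
    eapply filter_imp; [|apply (H (mkposreal _ He'))].
    intros x Hx. apply ball_C_inv in Hx. simpl in Hx. lra.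
  - intros H e. eapply filter_imp; [|apply (H e (cond_pos e))].
    intros x Hx. now apply ball_C.
Qed.

Lemma locally_C_eps (z : C) (P : C -> Prop) :
  locally z P <-> exists d, 0 < d /\ forall w, Cmod (w - z) < d -> P w.
Proof.
  split.
  - intros [d Hd]. exists d. split; [apply cond_pos|].
    intros w Hw. apply Hd. now apply ball_C.
  - intros [d [Hd H]]. assert (Hd' : 0 < d / 2) by lra.
    exists (mkposreal _ Hd'). intros w Hw. apply H.
    apply ball_C_inv in Hw. simpl in Hw. lra.
Qed.

Lemma locally_R_eps (t : R) (P : R -> Prop) :
  locally t P <-> exists d, 0 < d /\ forall s, Rabs (s - t) < d -> P s.
Proof.
  split.
  - intros [d Hd]. exists d. split; [apply cond_pos|]. exact Hd.
  - intros [d [Hd H]]. exists (mkposreal _ Hd). exact H.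
Qed.

Lemma continuous_C {T : UniformSpace} (f : T -> C) (x : T) :
  continuous f x <-> forall e, 0 < e -> locally x (fun y => Cmod (f y - f x) < e).
Proof. apply filterlim_C, locally_filter. Qed.

Lemma continuous_CC (f : C -> C) (z : C) :
  continuous f z <-> forall e, 0 < e -> exists d, 0 < d /\
    forall w, Cmod (w - z) < d -> Cmod (f w - f z) < e.
Proof.
  rewrite continuous_C. split; intros H e He; specialize (H e He);
  now apply locally_C_eps.
Qed.

Lemma continuous_RC (f : R -> C) (t : R) :
  continuous f t <-> forall e, 0 < e -> exists d, 0 < d /\
    forall s, Rabs (s - t) < d -> Cmod (f s - f t) < e.
Proof.
  rewrite continuous_C. split; intros H e He; specialize (H e He);
  now apply locally_R_eps.
Qed.

Lemma continuous_pair {T : UniformSpace} (f g : T -> R) (x : T) :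
  continuous f x -> continuous g x -> continuous (fun y => (f y, g y) : C) x.
Proof.
  intros Hf Hg. apply continuous_C. intros e He.
  assert (He' : 0 < e / 2) by lra.
  apply filterlim_locally with (eps := mkposreal _ He') in Hf.
  apply filterlim_locally with (eps := mkposreal _ He') in Hg.
  generalize (filter_and _ _ Hf Hg). apply filter_imp.
  intros y [H1 H2]. eapply Rle_lt_trans; [apply Cmod_le_sum|].
  change (Rabs (f y - f x) < e / 2) in H1.
  change (Rabs (g y - g x) < e / 2) in H2. simpl.
  unfold Rminus in *. lra.
Qed.

Lemma continuous_fstC (z : C) : continuous (fun w : C => fst w) z.
Proof. apply continuous_fst. Qed.

Lemma continuous_sndC (z : C) : continuous (fun w : C => snd w) z.
Proof. apply continuous_snd. Qed.

Lemma continuous_Re_comp {T : UniformSpace} (f : T -> C) x :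
  continuous f x -> continuous (fun y => fst (f y)) x.
Proof. intros H. apply (continuous_comp f (fun w : C => fst w)); auto using continuous_fstC. Qed.

Lemma continuous_Im_comp {T : UniformSpace} (f : T -> C) x :
  continuous f x -> continuous (fun y => snd (f y)) x.
Proof. intros H. apply (continuous_comp f (fun w : C => snd w)); auto using continuous_sndC. Qed.

Section Algebra.
Context {T : UniformSpace}.
Implicit Types (f g : T -> C) (x : T).

Lemma continuous_Cplus f g x :
  continuous f x -> continuous g x -> continuous (fun y => f y + g y)%C x.
Proof.
  intros Hf Hg. apply continuous_pair; simpl;
  apply (continuous_plus (V := R_NormedModule));
  auto using continuous_Re_comp, continuous_Im_comp.
Qed.

Lemma continuous_Copp f x :
  continuous f x -> continuous (fun y => - f y)%C x.
Proof.
  intros Hf. apply continuous_pair; simpl;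
  apply (continuous_opp (V := R_NormedModule));
  auto using continuous_Re_comp, continuous_Im_comp.
Qed.

Lemma continuous_Cminus f g x :
  continuous f x -> continuous g x -> continuous (fun y => f y - g y)%C x.
Proof. intros. apply continuous_Cplus; auto using continuous_Copp. Qed.

Lemma continuous_Cmult f g x :
  continuous f x -> continuous g x -> continuous (fun y => f y * g y)%C x.
Proof.
  intros Hf Hg. apply continuous_pair; simpl.
  - apply (continuous_minus (V := R_NormedModule));
    apply (continuous_mult (K := R_AbsRing));
    auto using continuous_Re_comp, continuous_Im_comp.
  - apply (continuous_plus (V := R_NormedModule));
    apply (continuous_mult (K := R_AbsRing));
    auto using continuous_Re_comp, continuous_Im_comp.
Qed.

Lemma continuous_inv_comp (h : T -> R) x :
  h x <> 0 -> continuous h x -> continuous (fun y => / h y) x.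
Proof. intros H1 H2. apply continuous_comp; [exact H2|now apply continuous_Rinv]. Qed.

Lemma continuous_Cinv f x :
  f x <> 0%C -> continuous f x -> continuous (fun y => / f y)%C x.
Proof.
  intros Hn Hf.
  assert (Hd : continuous (fun y => / (fst (f y) ^ 2 + snd (f y) ^ 2)) x).
  { apply continuous_inv_comp.
    - intros E. apply Hn. apply Cmod_eq_0.
      unfold Cmod. rewrite E. apply sqrt_0.
    - simpl. apply (continuous_plus (V := R_NormedModule));
      repeat (apply (continuous_mult (K := R_AbsRing)));
      auto using continuous_Re_comp, continuous_Im_comp, continuous_const. }
  apply continuous_pair; simpl; unfold Rdiv;
  apply (continuous_mult (K := R_AbsRing)); auto.
  - now apply continuous_Re_comp.
  - apply (continuous_opp (V := R_NormedModule)). now apply continuous_Im_comp.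
Qed.

(** Caratheodory's form of differentiability: [f] has derivative [l] at [x] when
    its slope towards [x], measured against [i], extends continuously by [l].
    Taking [i] to be the identity of [C] or the inclusion of [R] covers complex
    derivatives and velocities of curves at once, and the calculus rules become
    identities between slopes. *)
Definition slope_limit (i f : T -> C) (x : T) (l : C) : Prop :=
  exists q : T -> C, continuous q x /\ q x = l /\
    forall y, f y = (f x + q y * (i y - i x))%C.

Lemma slope_limit_continuous i f x l :
  continuous i x -> slope_limit i f x l -> continuous f x.
Proof.
  intros Hi [q [Hq [_ E]]].
  apply (continuous_ext (fun y => f x + q y * (i y - i x))%C).
  { intros y. now rewrite <- E. }
  apply continuous_Cplus; [apply continuous_const|].
  apply continuous_Cmult; auto.
  apply continuous_Cminus; auto using continuous_const.
Qed.

Lemma slope_limit_eq i f x l l' : slope_limit i f x l -> l = l' -> slope_limit i f x l'.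
Proof. now intros H <-. Qed.

Lemma slope_limit_const i c x : slope_limit i (fun _ => c) x 0%C.
Proof.
  exists (fun _ => 0%C). split; [apply continuous_const|]. split; [auto|].
  intros; ring.
Qed.

Lemma slope_limit_id i x : slope_limit i i x 1%C.
Proof.
  exists (fun _ => 1%C). split; [apply continuous_const|]. split; [auto|].
  intros; ring.
Qed.

Lemma slope_limit_plus i f g x l m :
  slope_limit i f x l -> slope_limit i g x m ->
  slope_limit i (fun y => f y + g y)%C x (l + m)%C.
Proof.
  intros [q [Hq [Hql E]]] [r [Hr [Hrl G]]].
  exists (fun y => q y + r y)%C. repeat split.
  - now apply continuous_Cplus.
  - now rewrite Hql, Hrl.
  - intros y. rewrite (E y), (G y). ring.
Qed.

Lemma slope_limit_mult i f g x l m : continuous i x ->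
  slope_limit i f x l -> slope_limit i g x m ->
  slope_limit i (fun y => f y * g y)%C x (l * g x + f x * m)%C.
Proof.
  intros Hi Hf Hg. pose proof (slope_limit_continuous _ _ _ _ Hi Hg) as Cg.
  destruct Hf as [q [Hq [Hql E]]], Hg as [r [Hr [Hrl G]]].
  exists (fun y => q y * g y + f x * r y)%C. repeat split.
  - apply continuous_Cplus; apply continuous_Cmult; auto using continuous_const.
  - now rewrite Hql, Hrl.
  - intros y. rewrite (E y), (G y). ring.
Qed.

Lemma slope_limit_scal i f x l c : continuous i x ->
  slope_limit i f x l -> slope_limit i (fun y => c * f y)%C x (c * l)%C.
Proof.
  intros Hi Hf. eapply slope_limit_eq.
  - apply slope_limit_mult; [exact Hi|apply slope_limit_const|exact Hf].
  - cbv beta. ring.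
Qed.

Lemma slope_limit_opp i f x l : continuous i x ->
  slope_limit i f x l -> slope_limit i (fun y => - f y)%C x (- l)%C.
Proof.
  intros Hi [q [Hq [Hql E]]]. exists (fun y => - q y)%C. repeat split.
  - now apply continuous_Copp.
  - now rewrite Hql.
  - intros y. rewrite (E y). ring.
Qed.

Lemma slope_limit_minus i f g x l m : continuous i x ->
  slope_limit i f x l -> slope_limit i g x m ->
  slope_limit i (fun y => f y - g y)%C x (l - m)%C.
Proof. intros Hi Hf Hg. apply slope_limit_plus; auto using slope_limit_opp. Qed.

End Algebra.

Notation cderiv := (slope_limit (T := C_UniformSpace) (fun z : C => z)).
Notation vderiv := (slope_limit (T := R_UniformSpace) RtoC).

Lemma continuous_RtoC (t : R) : continuous RtoC t.
Proof. apply continuous_pair; [apply continuous_id|apply continuous_const]. Qed.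

Lemma continuous_idC (z : C) : continuous (fun w : C => w) z.
Proof. apply continuous_id. Qed.

Lemma slope_limit_comp {T : UniformSpace} (i g : T -> C) (f : C -> C) x l m :
  continuous i x -> slope_limit i g x l -> cderiv f (g x) m ->
  slope_limit i (fun y => f (g y)) x (m * l)%C.
Proof.
  intros Hi Hg [r [Hr [Hrl G]]].
  pose proof (slope_limit_continuous _ _ _ _ Hi Hg) as Cg.
  destruct Hg as [q [Hq [Hql E]]].
  exists (fun y => r (g y) * q y)%C. repeat split.
  - apply continuous_Cmult; auto. apply (continuous_comp g r); auto.
  - now rewrite Hql, Hrl.
  - intros y. rewrite (G (g y)). rewrite (E y) at 2. ring.
Qed.

Lemma cderiv_inv (z : C) : z <> 0%C -> cderiv Cinv z (- / (z * z))%C.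
Proof.
  intros Hz. 
  exists (fun w : C => if excluded_middle_informative (w = RtoC 0) then (/ w - / z) / (w - z) else - / (z * w))%C.
  repeat split.
  - eapply continuous_ext_loc.
    2:{ apply (continuous_Copp (fun w => / (z * w))%C).
        apply (continuous_Cinv (fun w => z * w)%C).
        - now apply Cmult_neq_0.
        - apply continuous_Cmult; [apply continuous_const|apply continuous_id]. }
    apply locally_C_eps. exists (Cmod z). split; [now apply Cmod_gt_0|].
    intros w Hw. destruct excluded_middle_informative as [E|]; auto.
    subst w. exfalso. replace (0 - z)%C with (- z)%C in Hw by ring.
    rewrite Cmod_opp in Hw. lra.
  - destruct excluded_middle_informative; tauto.
  - intros w. destruct excluded_middle_informative.
    + set (u := (/ w)%C). set (v := (/ z)%C).
      assert (w - z <> 0)%C.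
      { intros E. apply Hz. replace z with (w - (w - z))%C by ring.
        rewrite E, e. ring. }
      field. auto.
    + field. auto.
Qed.

Lemma slope_limit_inv {T : UniformSpace} (i f : T -> C) x l :
  continuous i x -> f x <> 0%C -> slope_limit i f x l ->
  slope_limit i (fun y => / f y)%C x (- l / (f x * f x))%C.
Proof.
  intros Hi Hn Hf. eapply slope_limit_eq.
  - apply (slope_limit_comp i f Cinv); eauto. now apply cderiv_inv.
  - field. auto.
Qed.

Lemma slope_limit_ext_loc {T : UniformSpace} (i f g : T -> C) x l :
  (forall y, i y = i x -> y = x) ->
  f x = g x -> locally x (fun y => f y = g y) ->
  slope_limit i f x l -> slope_limit i g x l.
Proof.
  intros Hi Hx Hl [q [Hq [Hql E]]].
  exists (fun y => if excluded_middle_informative (f y = g y) then q y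
                   else (g y - g x) / (i y - i x))%C.
  repeat split.
  - eapply continuous_ext_loc; [|exact Hq].
    revert Hl. apply filter_imp. intros y Hy.
    destruct excluded_middle_informative; tauto.
  - destruct excluded_middle_informative; tauto.
  - intros y. destruct excluded_middle_informative as [e|n].
    + rewrite <- e, <- Hx. apply E.
    + field. intros H. apply n.
      replace y with x; auto. symmetry. apply Hi.
      replace (i y) with ((i y - i x) + i x)%C by ring. rewrite H. ring.
Qed.

Lemma slope_limit_eps {T : UniformSpace} (i f : T -> C) x l :
  slope_limit i f x l -> forall e, 0 < e ->
  locally x (fun y => Cmod (f y - f x - l * (i y - i x)) <= e * Cmod (i y - i x)).
Proof.
  intros [q [Hq [Hql E]]] e He.
  apply continuous_C with (e := e) in Hq; auto. revert Hq. apply filter_imp.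
  intros y Hy. rewrite (E y). rewrite Hql in Hy.
  replace (f x + q y * (i y - i x) - f x - l * (i y - i x))%C
    with ((q y - l) * (i y - i x))%C by ring.
  rewrite Cmod_mult. apply Rmult_le_compat_r; [apply Cmod_ge_0|lra].
Qed.

(** The identity between slopes forces [f y = f x] wherever [i y = i x], whence the
    first hypothesis. *)
Lemma eps_slope_limit {T : UniformSpace} (i f : T -> C) x l :
  (forall y, i y = i x -> y = x) ->
  (forall e, 0 < e ->
  locally x (fun y => Cmod (f y - f x - l * (i y - i x)) <= e * Cmod (i y - i x))) ->
  slope_limit i f x l.
Proof.
  intros Hi H.
  assert (Hne : forall y, y <> x -> (i y - i x)%C <> 0%C).
  { intros y Hy E. apply Hy, Hi.
    replace (i y) with ((i y - i x) + i x)%C by ring. rewrite E. ring. }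
  exists (fun y => if excluded_middle_informative (y = x) then l
                   else (f y - f x) / (i y - i x))%C.
  assert (E0 : (if excluded_middle_informative (x = x) then l
                   else (f x - f x) / (i x - i x))%C = l).
  { destruct excluded_middle_informative; tauto. }
  repeat split.
  - apply continuous_C. intros e He. rewrite E0.
    assert (He' : 0 < e / 2) by lra. generalize (H _ He'). apply filter_imp.
    intros y Hy. destruct (excluded_middle_informative (y = x)) as [_|n].
    + replace (l - l)%C with (RtoC 0) by ring. rewrite Cmod_0. lra.
    + specialize (Hne y n).
      replace ((f y - f x) / (i y - i x) - l)%C
        with ((f y - f x - l * (i y - i x)) / (i y - i x))%C by (field; auto).
      rewrite Cmod_div by auto.
      apply Cmod_gt_0 in Hne. apply Rle_lt_trans with (e / 2); [|lra].
      apply Rmult_le_reg_r with (Cmod (i y - i x)); auto.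
      unfold Rdiv. rewrite Rmult_assoc, Rinv_l, Rmult_1_r; lra.
  - exact E0.
  - intros y. destruct (excluded_middle_informative (y = x)) as [->|n].
    + ring.
    + field. auto.
Qed.

Lemma is_derive_vderiv (f : R -> C) (t : R) (v : C) :
  is_derive (fun s => fst (f s)) t (fst v) ->
  is_derive (fun s => snd (f s)) t (snd v) -> vderiv f t v.
Proof.
  intros [_ H1] [_ H2]. apply eps_slope_limit; [intros s; apply RtoC_inj|].
  intros e He. assert (He' : 0 < e / 2) by lra.
  assert (N : is_filter_lim (locally t) t) by (intros P HP; exact HP).
  generalize (H1 t N (mkposreal _ He')) (H2 t N (mkposreal _ He')).
  intros A B. generalize (filter_and _ _ A B). apply filter_imp.
  intros s [P1 P2]. rewrite <- RtoC_minus, Cmod_R.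
  eapply Rle_trans; [apply Cmod_le_sum|].
  unfold norm, minus, plus, opp, scal in P1, P2; simpl in P1, P2.
  unfold abs, mult in P1, P2; simpl in P1, P2. simpl.
  replace (fst (f s) + - fst (f t) + - (fst v * (s - t) - snd v * 0))
   with (fst (f s) + - fst (f t) + - ((s + - t) * fst v)) by ring.
  replace (snd (f s) + - snd (f t) + - (fst v * 0 + snd v * (s - t)))
   with (snd (f s) + - snd (f t) + - ((s + - t) * snd v)) by ring.
  unfold Rminus. lra.
Qed.

Lemma vderiv_is_derive (f : R -> C) (t : R) (v : C) : vderiv f t v ->
  is_derive (fun s => fst (f s)) t (fst v) /\
  is_derive (fun s => snd (f s)) t (snd v).
Proof.
  intros H. pose proof (slope_limit_eps _ _ _ _ H) as K.
  split; split; try apply is_linear_scal_l; intros x Hx e;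
  apply (is_filter_lim_locally_unique t x) in Hx; subst x;
  generalize (K e (cond_pos e)); apply filter_imp; intros s Hs;
  rewrite <- RtoC_minus, Cmod_R in Hs;
  unfold norm, minus, plus, opp, scal; simpl;
  unfold abs, mult; simpl; (eapply Rle_trans; [|apply Hs]).
  - eapply Rle_trans; [|apply Rabs_fst_le]. right. f_equal. simpl. ring.
  - eapply Rle_trans; [|apply Rabs_snd_le]. right. f_equal. simpl. ring.
Qed.

Lemma is_derive_C_R (f : R -> C) (t : R) (v : C) :
  is_derive (K := R_AbsRing) (V := C_R_NormedModule) f t v <-> vderiv f t v.
Proof.
  split.
  - intros H. apply is_derive_vderiv.
    + apply (filterdiff_comp' f (fun w : C_R_NormedModule => fst w) t _ (fun w : C_R_NormedModule => fst w)) in H; [exact H|].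
      apply filterdiff_linear. apply (is_linear_fst (U := R_NormedModule) (V := R_NormedModule)).
    + apply (filterdiff_comp' f (fun w : C_R_NormedModule => snd w) t _ (fun w : C_R_NormedModule => snd w)) in H; [exact H|].
      apply filterdiff_linear. apply (is_linear_snd (U := R_NormedModule) (V := R_NormedModule)).
  - intros H. apply vderiv_is_derive in H. destruct H as [H1 H2].
    unfold is_derive.
    split. apply is_linear_scal_l.
    intros x Hx e. apply (is_filter_lim_locally_unique t x) in Hx; subst x.
    assert (He' : 0 < e / 2) by (pose proof (cond_pos e); lra).
    destruct H1 as [_ H1], H2 as [_ H2].
    assert (N : is_filter_lim (locally t) t) by (intros P HP; exact HP).
    generalize (filter_and _ _ (H1 t N (mkposreal _ He')) (H2 t N (mkposreal _ He'))).
    apply filter_imp. intros s [P1 P2].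
    rewrite <- Cmod_norm.
    change (Cmod (minus (minus (f s) (f t)) (scal (minus s t) v : C_R_NormedModule)) <= e * Rabs (s - t)).
    eapply Rle_trans; [apply Cmod_le_sum|].
    change (Rabs (fst (f s) + - fst (f t) + - ((s + - t) * fst v)) <= e / 2 * Rabs (s - t)) in P1.
    change (Rabs (snd (f s) + - snd (f t) + - ((s + - t) * snd v)) <= e / 2 * Rabs (s - t)) in P2.
    change (Rabs (fst (f s) + - fst (f t) + - ((s + - t) * fst v)) +
      Rabs (snd (f s) + - snd (f t) + - ((s + - t) * snd v)) <= e * Rabs (s - t)).
    lra.
Qed.

Lemma is_derive_C_C (f : C -> C) (z l : C) :
  is_derive (K := C_AbsRing) (V := C_NormedModule) f z l -> cderiv f z l.
Proof.
  intros [_ H]. apply eps_slope_limit; [auto|].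
  intros e He.
  assert (N : is_filter_lim (locally (T := AbsRing_UniformSpace C_AbsRing) z) z)
    by (intros P HP; exact HP).
  generalize (H z N (mkposreal _ He)). intros K.
  apply locally_C. revert K. apply filter_imp. intros w Hw.
  change (Cmod (f w - f z - (w - z) * l) <= e * Cmod (w - z)) in Hw.
  now rewrite (Cmult_comm l).
Qed.

Lemma vderiv_continuous (f : R -> C) (t : R) (v : C) : vderiv f t v -> continuous f t.
Proof. apply (slope_limit_continuous (T := R_UniformSpace)). apply continuous_RtoC. Qed.

Lemma cderiv_continuous (f : C -> C) (z l : C) : cderiv f z l -> continuous f z.
Proof. apply (slope_limit_continuous (T := C_UniformSpace)). apply continuous_idC. Qed.

(** The real part of [u] times the conjugate of [v], the inner product of the plane. *)
Definition dot (u v : C) : R := fst u * fst v + snd u * snd v.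

Lemma dot_le (u v : C) : dot u v <= Cmod u * Cmod v.
Proof.
  apply Rsqr_incr_0_var.
  - unfold Rsqr.
    replace (Cmod u * Cmod v * (Cmod u * Cmod v))
      with ((Cmod u * Cmod u) * (Cmod v * Cmod v)) by ring.
    rewrite !Cmod_sqr. unfold dot.
    pose proof (Rle_0_sqr (fst u * snd v - snd u * fst v)). unfold Rsqr in *. nra.
  - apply Rmult_le_pos; apply Cmod_ge_0.
Qed.

Lemma dot_self (u : C) : dot u u = Cmod u * Cmod u.
Proof. now rewrite Cmod_sqr. Qed.

Lemma is_derive_dot_const (u : C) (f : R -> C) (t : R) (v : C) :
  vderiv f t v -> is_derive (fun s => dot u (f s)) t (dot u v).
Proof.
  intros H. apply vderiv_is_derive in H. destruct H as [H1 H2].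
  unfold dot. apply (is_derive_plus (V := R_NormedModule)).
  - now apply (is_derive_scal (fun s => fst (f s))).
  - now apply (is_derive_scal (fun s => snd (f s))).
Qed.

Lemma derive_le_increment (g dg : R -> R) (a b k : R) : a <= b ->
  (forall t, a <= t <= b -> is_derive g t (dg t) /\ dg t <= k) ->
  g b - g a <= k * (b - a).
Proof.
  intros Hab H.
  destruct (MVT_gen g a b dg) as [c [Hc E]];
    rewrite ?Rmin_left, ?Rmax_right by auto.
  - intros x Hx. apply H. lra.
  - intros x Hx. apply continuity_pt_filterlim.
    apply (ex_derive_continuous (V := R_NormedModule) g x). exists (dg x). apply H. lra.
  - rewrite Rmin_left, Rmax_right in Hc by auto. rewrite E.
    apply Rmult_le_compat_r; [lra|]. now apply H.
Qed.

(** The increment is measured against its own direction, which reduces the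
    inequality to the real mean value theorem without loss in the constant. *)
Lemma mean_value_inequality (f df : R -> C) (a b M : R) : a <= b ->
  (forall t, a <= t <= b -> vderiv f t (df t) /\ Cmod (df t) <= M) ->
  Cmod (f b - f a) <= M * (b - a).
Proof.
  intros Hab H. set (u := (f b - f a)%C).
  pose proof (Cmod_ge_0 u) as Hu.
  assert (HM : 0 <= M).
  { eapply Rle_trans; [apply Cmod_ge_0|apply (H a); lra]. }
  assert (K : dot u (f b) - dot u (f a) <= (Cmod u * M) * (b - a)).
  { apply (derive_le_increment (fun t => dot u (f t)) (fun t => dot u (df t))); auto.
    intros t Ht. destruct (H t Ht) as [H1 H2]. split.
    - now apply is_derive_dot_const.
    - eapply Rle_trans; [apply dot_le|]. now apply Rmult_le_compat_l. }
  replace (dot u (f b) - dot u (f a)) with (dot u u) in K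
    by (unfold u, dot; simpl; ring).
  rewrite dot_self in K. destruct Hu as [Hu|Hu].
  - apply Rmult_le_reg_l with (Cmod u); auto. lra.
  - rewrite <- Hu. apply Rmult_le_pos; lra.
Qed.

Lemma antiderivative_unique (f g df : R -> C) (a b : R) :
  (forall t, vderiv f t (df t)) -> (forall t, vderiv g t (df t)) ->
  (f b - f a = g b - g a)%C.
Proof.
  intros Hf Hg.
  assert (K : forall a b, a <= b -> (f b - f a = g b - g a)%C).
  { clear a b. intros a b Hab.
    assert (M := mean_value_inequality (fun t => f t - g t)%C
      (fun _ => RtoC 0) a b 0 Hab).
    assert (E : (f b - g b - (f a - g a) = 0)%C).
    { apply Cmod_eq_0. apply Rle_antisym; [|apply Cmod_ge_0].
      eapply Rle_trans; [apply M|lra].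
      intros t _. split.
      - eapply slope_limit_eq; [apply slope_limit_minus; auto using continuous_RtoC|].
        cbv beta; ring.
      - rewrite Cmod_0; lra. }
    replace (f b - f a)%C with ((f b - g b - (f a - g a)) + (g b - g a))%C by ring.
    rewrite E. ring. }
  destruct (Rle_lt_dec a b) as [h|h]; [auto|].
  replace (f b - f a)%C with (- (f a - f b))%C by ring.
  rewrite (K b a) by lra. ring.
Qed.

(** * Contour integrals and the theorem of Goursat *)

Definition CInt (f : R -> C) (a b : R) : C := RInt (V := C_R_CompleteNormedModule) f a b.

Lemma ex_CInt (f : R -> C) (a b : R) : (forall t, continuous f t) ->
  ex_RInt (V := C_R_CompleteNormedModule) f a b.
Proof. intros H. apply ex_RInt_continuous. intros z _. apply H. Qed.

Lemma CInt_vderiv (f : R -> C) (a t : R) : (forall t, continuous f t) ->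
  vderiv (fun s => CInt f a s) t (f t).
Proof.
  intros H. apply is_derive_C_R.
  apply (is_derive_RInt (V := C_R_CompleteNormedModule) f (fun s => CInt f a s) a t).
  - apply filter_forall. intros b. 
    apply (RInt_correct (V := C_R_CompleteNormedModule)). now apply ex_CInt.
  - apply H.
Qed.

Lemma CInt_point (f : R -> C) (a : R) : CInt f a a = 0%C.
Proof. unfold CInt. now rewrite RInt_point. Qed.

(** Integrals are handled only through this uniqueness of antiderivatives; all
    integrands are continuous on the whole line, so that no integrability condition
    arises later. *)
Lemma CInt_unique (f F : R -> C) (a b : R) : (forall t, continuous f t) ->
  (forall t, vderiv F t (f t)) -> CInt f a b = (F b - F a)%C.
Proof.
  intros Hf HF.
  rewrite <- (antiderivative_unique (fun s => CInt f a s) F f a b); auto.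
  - rewrite CInt_point. ring.
  - intros t. now apply CInt_vderiv.
Qed.

Lemma CInt_Chasles (f : R -> C) (a b c : R) : (forall t, continuous f t) ->
  (CInt f a b + CInt f b c = CInt f a c)%C.
Proof.
  intros Hf. apply (RInt_Chasles (V := C_R_CompleteNormedModule)); now apply ex_CInt.
Qed.

Lemma CInt_swap (f : R -> C) (a b : R) : (forall t, continuous f t) ->
  (CInt f a b = - CInt f b a)%C.
Proof.
  intros Hf. pose proof (CInt_Chasles f a b a Hf) as E. rewrite CInt_point in E.
  replace (CInt f a b) with ((CInt f a b + CInt f b a) - CInt f b a)%C by ring.
  rewrite E. ring.
Qed.

Lemma CInt_plus (f g : R -> C) (a b : R) :
  (forall t, continuous f t) -> (forall t, continuous g t) ->
  CInt (fun t => f t + g t)%C a b = (CInt f a b + CInt g a b)%C.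
Proof.
  intros Hf Hg.
  rewrite (CInt_unique (fun t => f t + g t)%C (fun t => CInt f a t + CInt g a t)%C a b).
  - rewrite !CInt_point. ring.
  - intros t. now apply continuous_Cplus.
  - intros t. apply slope_limit_plus; now apply CInt_vderiv.
Qed.

Lemma CInt_bound (f : R -> C) (a b M : R) : (forall t, continuous f t) ->
  (forall t, Rmin a b <= t <= Rmax a b -> Cmod (f t) <= M) ->
  Cmod (CInt f a b) <= M * Rabs (b - a).
Proof.
  intros Hf.
  assert (K : forall a b, a <= b -> (forall t, a <= t <= b -> Cmod (f t) <= M) ->
     Cmod (CInt f a b) <= M * (b - a)).
  { clear a b. intros a b Hab H.
    replace (CInt f a b) with (CInt f a b - CInt f a a)%C
      by (rewrite CInt_point; ring).
    apply (mean_value_inequality (fun s => CInt f a s) f); auto.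
    intros t Ht. split; [now apply CInt_vderiv|auto]. }
  destruct (Rle_lt_dec a b) as [h|h]; intros H.
  - rewrite Rmin_left, Rmax_right in H by auto.
    rewrite Rabs_pos_eq by lra. auto.
  - rewrite Rmin_right, Rmax_left in H by lra.
    rewrite Rabs_left by lra. rewrite CInt_swap, Cmod_opp by auto.
    replace (- (b - a)) with (a - b) by ring. apply K; auto; lra.
Qed.

(** Bisection: a property of rectangles that passes from the four quarters to
    the whole fails on a nested sequence of rectangles if it fails at all, hence
    fails on arbitrarily small rectangles around some point. *)
Lemma rectangle_induction (P : R -> R -> R -> R -> Prop) (a b c d : R) :
  (forall a b c d, a <= b -> c <= d ->
    P a ((a + b) / 2) c ((c + d) / 2) -> P ((a + b) / 2) b c ((c + d) / 2) ->
    P a ((a + b) / 2) ((c + d) / 2) d -> P ((a + b) / 2) b ((c + d) / 2) d ->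
    P a b c d) ->
  a <= b -> c <= d ->
  (forall x y, a <= x <= b -> c <= y <= d -> exists delta, 0 < delta /\
    forall a' b' c' d', a <= a' <= x -> x <= b' <= b -> c <= c' <= y ->
      y <= d' <= d -> b' - a' < delta -> d' - c' < delta -> P a' b' c' d') ->
  P a b c d.
Proof.
  intros Hq Hab Hcd Hloc. apply NNPP. intros Hn.
  set (rect := (R * R * (R * R))%type).
  set (PP := fun r : rect => P (fst (fst r)) (snd (fst r)) (fst (snd r)) (snd (snd r))).
  set (wf := fun r : rect => fst (fst r) <= snd (fst r) /\ fst (snd r) <= snd (snd r)).
  set (quarter := fun r s : rect => wf s /\
     fst (fst r) <= fst (fst s) /\ snd (fst s) <= snd (fst r) /\
     fst (snd r) <= fst (snd s) /\ snd (snd s) <= snd (snd r) /\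
     snd (fst s) - fst (fst s) = (snd (fst r) - fst (fst r)) / 2 /\
     snd (snd s) - fst (snd s) = (snd (snd r) - fst (snd r)) / 2).
  assert (Hstep : forall r, exists s, wf r -> ~ PP r -> quarter r s /\ ~ PP s).
  { intros r. destruct (classic (wf r /\ ~ PP r)) as [[Hw Hr]|Hr].
    2:{ exists r. tauto. }
    destruct r as [[x0 x1] [y0 y1]]. unfold wf, PP in Hw, Hr. simpl in Hw, Hr.
    destruct Hw as [Hx Hy].
    apply NNPP. intros Hno. apply Hr.
    apply Hq; auto; apply NNPP; intros Hs; apply Hno.
    - exists ((x0, (x0 + x1) / 2), (y0, (y0 + y1) / 2)).
      intros _ _. split; auto. unfold quarter, wf. simpl. repeat split; lra.
    - exists (((x0 + x1) / 2, x1), (y0, (y0 + y1) / 2)).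
      intros _ _. split; auto. unfold quarter, wf. simpl. repeat split; lra.
    - exists ((x0, (x0 + x1) / 2), ((y0 + y1) / 2, y1)).
      intros _ _. split; auto. unfold quarter, wf. simpl. repeat split; lra.
    - exists (((x0 + x1) / 2, x1), ((y0 + y1) / 2, y1)).
      intros _ _. split; auto. unfold quarter, wf. simpl. repeat split; lra. }
  apply choice in Hstep. destruct Hstep as [next Hnext].
  set (seq := fix seq (n : nat) : rect :=
     match n with O => ((a, b), (c, d)) | S m => next (seq m) end).
  assert (Hseq : forall n, wf (seq n) /\ ~ PP (seq n)).
  { induction n as [|n [IH1 IH2]].
    - split; [split; auto|exact Hn].
    - simpl. destruct (Hnext _ IH1 IH2) as [[H1 _] H2]. auto. }
  assert (Hqs : forall n, quarter (seq n) (seq (S n))).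
  { intros n. destruct (Hseq n) as [H1 H2]. apply (Hnext _ H1 H2). }
  set (al := fun n => fst (fst (seq n))). set (be := fun n => snd (fst (seq n))).
  set (ga := fun n => fst (snd (seq n))). set (de := fun n => snd (snd (seq n))).
  assert (Hmono : forall k n, al n <= al (k + n)%nat /\ be (k + n)%nat <= be n
     /\ ga n <= ga (k + n)%nat /\ de (k + n)%nat <= de n).
  { induction k as [|k IH]; intros n; [simpl; lra|].
    specialize (IH n). destruct (Hqs (k + n)%nat) as (_ & q1 & q2 & q3 & q4 & _).
    fold (al (k+n)%nat) (be (k+n)%nat) (ga (k+n)%nat) (de (k+n)%nat)
      (al (S (k+n))) (be (S (k+n))) (ga (S (k+n))) (de (S (k+n))) in q1, q2, q3, q4.
    change (S k + n)%nat with (S (k + n)). lra. }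
  assert (Hlen : forall n, be n - al n = (b - a) / 2 ^ n /\ de n - ga n = (d - c) / 2 ^ n).
  { induction n as [|n [IH1 IH2]].
    - simpl. unfold al, be, ga, de. simpl. lra.
    - destruct (Hqs n) as (_ & _ & _ & _ & _ & q1 & q2).
      fold (al n) (be n) (ga n) (de n) (al (S n)) (be (S n)) (ga (S n)) (de (S n)) in q1, q2.
      rewrite q1, q2, IH1, IH2. simpl. pose proof (pow_lt 2 n ltac:(lra)).
      split; field; lra. }
  assert (Hle : forall n m, al n <= be m /\ ga n <= de m).
  { intros n m. destruct (Hmono n m) as (m1 & m2 & m3 & m4).
    destruct (Hmono m n) as (k1 & k2 & k3 & k4).
    rewrite (Nat.add_comm m n) in k1, k2, k3, k4.
    destruct (Hseq (n + m)%nat) as [[w1 w2] _].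
    fold (al (n + m)%nat) (be (n + m)%nat) (ga (n + m)%nat) (de (n + m)%nat) in w1, w2. lra. }
  assert (Hsup : forall u v : nat -> R, (forall n m, u n <= v m) ->
     exists x, forall n, u n <= x <= v n).
  { intros u v Huv.
    destruct (completeness (fun x => exists n, x = u n)) as [x [H1 H2]].
    - exists (v O). intros x [n ->]. auto.
    - exists (u O). now exists O.
    - exists x. intros n. split.
      + apply H1. now exists n.
      + apply H2. intros y [m ->]. auto. }
  destruct (Hsup al be) as [x Hx]; [intros; apply Hle|].
  destruct (Hsup ga de) as [y Hy]; [intros; apply Hle|].
  destruct (Hloc x y (Hx O) (Hy O)) as [delta [Hd HP]].
  assert (Hsmall : exists n, (b - a) / 2 ^ n < delta /\ (d - c) / 2 ^ n < delta).
  { destruct (Pow_x_infinity 2) with (b := (b - a + (d - c)) / delta + 1) as [n Hn'].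
    { rewrite Rabs_pos_eq; lra. }
    specialize (Hn' n (le_n n)). exists n.
    pose proof (pow_lt 2 n ltac:(lra)) as Hp. rewrite Rabs_pos_eq in Hn' by lra.
    assert (b - a + (d - c) < delta * 2 ^ n).
    { replace (b - a + (d - c)) with (delta * ((b - a + (d - c)) / delta)) by (field; lra).
      apply Rmult_lt_compat_l; lra. }
    split; apply Rmult_lt_reg_r with (2 ^ n); auto;
    unfold Rdiv; rewrite Rmult_assoc, Rinv_l, Rmult_1_r; lra. }
  destruct Hsmall as [n [n1 n2]].
  destruct (Hseq n) as [_ Hf]. apply Hf.
  destruct (Hlen n) as [l1 l2]. destruct (Hmono n O) as (m1 & m2 & m3 & m4).
  rewrite Nat.add_0_r in m1, m2, m3, m4.
  change (al O) with a in m1. change (be O) with b in m2.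
  change (ga O) with c in m3. change (de O) with d in m4.
  specialize (Hx n). specialize (Hy n).
  apply HP; fold (al n) (be n) (ga n) (de n); lra.
Qed.

Lemma continuous_locally_bounded (f : C -> C) (z : C) : continuous f z ->
  exists d B, 0 < d /\ forall w, Cmod (w - z) < d -> Cmod (f w) <= B.
Proof.
  intros H. apply continuous_CC with (e := 1) in H; [|lra].
  destruct H as [d [Hd H]]. exists d, (Cmod (f z) + 1). split; auto.
  intros w Hw. specialize (H w Hw).
  replace (f w) with ((f w - f z) + f z)%C by ring.
  eapply Rle_trans; [apply Cmod_triangle|lra].
Qed.

Lemma continuous_bounded (f : C -> C) (r : R) : (forall z, continuous f z) ->
  exists B, forall z, Cmod z <= r -> Cmod (f z) <= B.
Proof.
  intros Hf. destruct (Rle_lt_dec 0 r) as [Hr|Hr].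
  2:{ exists 0. intros z Hz. pose proof (Cmod_ge_0 z). lra. }
  assert (K : exists B, forall z : C, - r <= fst z <= r -> - r <= snd z <= r -> Cmod (f z) <= B).
  { apply (rectangle_induction (fun a b c d => exists B, forall z : C,
      a <= fst z <= b -> c <= snd z <= d -> Cmod (f z) <= B)); try lra.
    - intros a b c d Hab Hcd [B1 H1] [B2 H2] [B3 H3] [B4 H4].
      exists (Rmax (Rmax B1 B2) (Rmax B3 B4)). intros z Hx Hy.
      pose proof (Rmax_l B1 B2); pose proof (Rmax_r B1 B2);
      pose proof (Rmax_l B3 B4); pose proof (Rmax_r B3 B4);
      pose proof (Rmax_l (Rmax B1 B2) (Rmax B3 B4));
      pose proof (Rmax_r (Rmax B1 B2) (Rmax B3 B4)).
      destruct (Rle_lt_dec (fst z) ((a + b) / 2)), (Rle_lt_dec (snd z) ((c + d) / 2)).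
      + assert (Cmod (f z) <= B1) by (apply H1; lra). lra.
      + assert (Cmod (f z) <= B3) by (apply H3; lra). lra.
      + assert (Cmod (f z) <= B2) by (apply H2; lra). lra.
      + assert (Cmod (f z) <= B4) by (apply H4; lra). lra.
    - intros x y Hx Hy.
      destruct (continuous_locally_bounded f (x, y) (Hf _)) as [d [B [Hd H]]].
      exists (d / 2). split; [lra|]. intros a' b' c' d' h1 h2 h3 h4 h5 h6.
      exists B. intros z Hz1 Hz2. apply H.
      eapply Rle_lt_trans; [apply Cmod_le_sum|]. simpl.
      assert (Rabs (fst z + - x) < d / 2) by (apply Rabs_def1; lra).
      assert (Rabs (snd z + - y) < d / 2) by (apply Rabs_def1; lra). lra. }
  destruct K as [B HB]. exists B. intros z Hz.
  apply HB; apply Rabs_le_between; eapply Rle_trans;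
    [apply Rabs_fst_le|auto|apply Rabs_snd_le|auto].
Qed.

(** The contour integral over the boundary, counterclockwise when [a <= b] and
    [c <= d]; the formula is kept for arbitrary [a], [b], [c], [d], where it is
    antisymmetric in each pair. *)
Definition rect_integral (f : C -> C) (a b c d : R) : C :=
  (CInt (fun s => f (s, c)) a b - CInt (fun s => f (s, d)) a b
   + Ci * (CInt (fun s => f (b, s)) c d - CInt (fun s => f (a, s)) c d))%C.

Lemma continuous_hor (y t : R) : continuous (fun s : R => (s, y) : C) t.
Proof. apply continuous_pair; [apply continuous_id|apply continuous_const]. Qed.

Lemma continuous_ver (x t : R) : continuous (fun s : R => (x, s) : C) t.
Proof. apply continuous_pair; [apply continuous_const|apply continuous_id]. Qed.

Lemma vderiv_hor (y t : R) : vderiv (fun s : R => (s, y) : C) t 1%C.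
Proof.
  apply is_derive_vderiv; simpl; [apply (is_derive_id (K := R_AbsRing))|apply (is_derive_const (V := R_NormedModule))].
Qed.

Lemma vderiv_ver (x t : R) : vderiv (fun s : R => (x, s) : C) t Ci.
Proof.
  apply is_derive_vderiv; simpl; [apply (is_derive_const (V := R_NormedModule))|apply (is_derive_id (K := R_AbsRing))].
Qed.

Section Rectangles.
Variable f : C -> C.
Hypothesis f_cont : forall z, continuous f z.

Lemma continuous_along_hor (y t : R) : continuous (fun s : R => f (s, y)) t.
Proof. apply (continuous_comp (fun s : R => (s, y) : C) f); auto using continuous_hor. Qed.

Lemma continuous_along_ver (x t : R) : continuous (fun s : R => f (x, s)) t.
Proof. apply (continuous_comp (fun s : R => (x, s) : C) f); auto using continuous_ver. Qed.

Lemma rect_integral_split (a b c d m n : R) :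
  rect_integral f a b c d =
   (rect_integral f a m c n + rect_integral f m b c n
    + (rect_integral f a m n d + rect_integral f m b n d))%C.
Proof.
  unfold rect_integral.
  rewrite <- (CInt_Chasles (fun s => f (s, c)) a m b) by apply continuous_along_hor.
  rewrite <- (CInt_Chasles (fun s => f (s, d)) a m b) by apply continuous_along_hor.
  rewrite <- (CInt_Chasles (fun s => f (b, s)) c n d) by apply continuous_along_ver.
  rewrite <- (CInt_Chasles (fun s => f (a, s)) c n d) by apply continuous_along_ver.
  ring.
Qed.

Lemma rect_integral_bound (a b c d M : R) : a <= b -> c <= d ->
  (forall z : C, a <= fst z <= b -> c <= snd z <= d -> Cmod (f z) <= M) ->
  Cmod (rect_integral f a b c d) <= 2 * M * ((b - a) + (d - c)).
Proof.
  intros Hab Hcd H. unfold rect_integral.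
  assert (E1 : forall y, c <= y <= d -> Cmod (CInt (fun s => f (s, y)) a b) <= M * (b - a)).
  { intros y Hy. rewrite <- (Rabs_pos_eq (b - a)) by lra.
    apply CInt_bound; [apply continuous_along_hor|].
    rewrite Rmin_left, Rmax_right by auto. intros t Ht. now apply H. }
  assert (E2 : forall x, a <= x <= b -> Cmod (CInt (fun s => f (x, s)) c d) <= M * (d - c)).
  { intros x Hx. rewrite <- (Rabs_pos_eq (d - c)) by lra.
    apply CInt_bound; [apply continuous_along_ver|].
    rewrite Rmin_left, Rmax_right by auto. intros t Ht. now apply H. }
  pose proof (E1 c ltac:(lra)); pose proof (E1 d ltac:(lra)).
  pose proof (E2 a ltac:(lra)); pose proof (E2 b ltac:(lra)).
  eapply Rle_trans; [apply Cmod_triangle|].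
  rewrite Cmod_mult, Cmod_Ci.
  assert (T : forall u v : C, Cmod (u - v) <= Cmod u + Cmod v).
  { intros u v. rewrite <- (Cmod_opp v). apply Cmod_triangle. }
  eapply Rle_trans; [apply Rplus_le_compat; [apply T|rewrite Rmult_1_l; apply T]|]. lra.
Qed.

End Rectangles.

Lemma rect_integral_plus (f g : C -> C) (a b c d : R) :
  (forall z, continuous f z) -> (forall z, continuous g z) ->
  rect_integral (fun z => f z + g z)%C a b c d =
  (rect_integral f a b c d + rect_integral g a b c d)%C.
Proof.
  intros Hf Hg. unfold rect_integral.
  rewrite !(CInt_plus (fun s => f (s, _)) (fun s => g (s, _)))
    by (intros; now apply continuous_along_hor).
  rewrite !(CInt_plus (fun s => f (_, s)) (fun s => g (_, s)))
    by (intros; now apply continuous_along_ver).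
  ring.
Qed.

Lemma Ci_rotate (u : C) : (- Ci * (u * Ci) = u)%C.
Proof. destruct u as [x y]. unfold Ci, Cmult, Copp; simpl. f_equal; ring. Qed.

Lemma rect_integral_primitive (f F : C -> C) (a b c d : R) :
  (forall z, continuous f z) -> (forall z, cderiv F z (f z)) ->
  rect_integral f a b c d = 0%C.
Proof.
  intros Hf HF.
  assert (H1 : forall y, CInt (fun s => f (s, y)) a b = (F (b, y) - F (a, y))%C).
  { intros y. apply (CInt_unique _ (fun s => F (s, y))).
    - now apply continuous_along_hor.
    - intros t. eapply slope_limit_eq.
      + apply (slope_limit_comp (T := R_UniformSpace) RtoC (fun s : R => (s, y) : C) F);
        [apply continuous_RtoC|apply vderiv_hor|apply HF].
      + ring. }
  assert (H2 : forall x, (Ci * CInt (fun s => f (x, s)) c d = F (x, d) - F (x, c))%C).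
  { intros x.
    rewrite (CInt_unique (fun s => f (x, s)) (fun s => - Ci * F (x, s))%C).
    - rewrite <- (Ci_rotate (F (x, d))) at 2. rewrite <- (Ci_rotate (F (x, c))) at 2. ring.
    - now apply continuous_along_ver.
    - intros t. eapply slope_limit_eq.
      + apply slope_limit_scal; [apply continuous_RtoC|].
        apply (slope_limit_comp (T := R_UniformSpace) RtoC (fun s : R => (x, s) : C) F);
        [apply continuous_RtoC|apply vderiv_ver|apply HF].
      + apply Ci_rotate. }
  unfold rect_integral.
  replace (Ci * (CInt (fun s => f (b, s)) c d - CInt (fun s => f (a, s)) c d))%C
    with (Ci * CInt (fun s => f (b, s)) c d - Ci * CInt (fun s => f (a, s)) c d)%C by ring.
  rewrite !H1, !H2. ring.
Qed.

(** The quantity [e * (width + height) ^ 2] is additive over the four quarters of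
    a rectangle, and on a small rectangle around [p] it dominates the integral of
    [f], because the affine part of [f] at [p] has a primitive and the remainder
    is small compared with the diameter. *)
Lemma goursat (f : C -> C) (a b c d : R) : (forall z, continuous f z) ->
  a <= b -> c <= d ->
  (forall z : C, a <= fst z <= b -> c <= snd z <= d -> exists l, cderiv f z l) ->
  rect_integral f a b c d = 0%C.
Proof.
  intros Hf Hab Hcd Hd.
  assert (K : forall e, 0 < e ->
    Cmod (rect_integral f a b c d) <= e * ((b - a) + (d - c)) ^ 2).
  { intros e He. pattern a, b, c, d. apply rectangle_induction; auto.
    - clear a b c d Hab Hcd Hd. intros a b c d Hab Hcd H1 H2 H3 H4.
      rewrite (rect_integral_split f Hf a b c d ((a + b) / 2) ((c + d) / 2)).
      eapply Rle_trans; [apply Cmod_triangle|].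
      eapply Rle_trans; [apply Rplus_le_compat; apply Cmod_triangle|].
      nra.
    - intros x y Hx Hy. destruct (Hd (x, y)) as [l Hl]; auto.
      pose proof (slope_limit_eps _ _ _ _ Hl (e / 2) ltac:(lra)) as H.
      apply locally_C_eps in H. destruct H as [dl [Hdl H]].
      exists (dl / 2). split; [lra|]. intros a' b' c' d' h1 h2 h3 h4 h5 h6.
      set (p := (x, y) : C).
      set (lin := fun z : C => (f p + l * (z - p))%C).
      set (err := fun z : C => (f z - f p - l * (z - p))%C).
      assert (Clin : forall z, continuous lin z).
      { intros z. apply continuous_Cplus; [apply continuous_const|].
        apply continuous_Cmult; [apply continuous_const|].
        apply continuous_Cminus; [apply continuous_id|apply continuous_const]. }
      assert (Cerr : forall z, continuous err z).
      { intros z. apply continuous_Cminus; [apply continuous_Cminus|]; auto using continuous_const.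
        apply continuous_Cmult; [apply continuous_const|].
        apply continuous_Cminus; [apply continuous_id|apply continuous_const]. }
      assert (Esum : forall z, f z = (lin z + err z)%C).
      { intros z. unfold lin, err. ring. }
      assert (E : rect_integral f a' b' c' d' = rect_integral err a' b' c' d').
      { transitivity (rect_integral (fun z => lin z + err z)%C a' b' c' d').
        - unfold rect_integral, CInt.
          f_equal; [f_equal|f_equal; f_equal]; apply RInt_ext;
          intros; apply Esum.
        - rewrite rect_integral_plus by auto.
          rewrite (rect_integral_primitive lin
            (fun z => f p * z + l / 2 * ((z - p) * (z - p)))%C); auto.
          + ring.
          + intros z. eapply slope_limit_eq.
            * apply slope_limit_plus.
              -- apply slope_limit_scal; [apply continuous_idC|apply slope_limit_id].
              -- apply slope_limit_scal; [apply continuous_idC|].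
                 apply (slope_limit_mult (T := C_UniformSpace) (fun w : C => w) (fun w : C => (w - p)%C) (fun w : C => (w - p)%C));
                 [apply continuous_idC| |];
                 (apply slope_limit_minus; [apply continuous_idC|apply slope_limit_id|apply slope_limit_const]).
            * unfold lin. field. }
      rewrite E.
      replace (e * (b' - a' + (d' - c')) ^ 2)
        with (2 * (e / 2 * (b' - a' + (d' - c'))) * (b' - a' + (d' - c'))) by field.
      apply rect_integral_bound; auto; try lra.
      intros z Hz1 Hz2.
      assert (A1 : Rabs (fst z - x) <= b' - a') by (apply Rabs_le; lra).
      assert (A2 : Rabs (snd z - y) <= d' - c') by (apply Rabs_le; lra).
      assert (A3 : Cmod (z - p) <= b' - a' + (d' - c')).
      { eapply Rle_trans; [apply Cmod_le_sum|]. simpl. unfold Rminus in *. lra. }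
      eapply Rle_trans; [apply H; fold p; lra|].
      apply Rmult_le_compat_l; [lra|exact A3]. }
  apply Cmod_eq_0. apply Rle_antisym; [|apply Cmod_ge_0].
  apply le_epsilon. intros e He. rewrite Rplus_0_l.
  set (s := (b - a + (d - c)) ^ 2) in K.
  assert (Hs : 0 <= s) by apply pow2_ge_0.
  eapply Rle_trans; [apply (K (e / (s + 1)))|].
  - apply Rdiv_lt_0_compat; lra.
  - apply Rmult_le_reg_r with (s + 1); [lra|].
    replace (e / (s + 1) * s * (s + 1)) with (e * s) by (field; lra). nra.
Qed.

Lemma goursat_signed (f : C -> C) (r a b c d : R) : (forall z, continuous f z) ->
  (forall z : C, fst z < r -> exists l, cderiv f z l) ->
  a < r -> b < r -> rect_integral f a b c d = 0%C.
Proof.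
  intros Hf Hd.
  assert (K : forall a b c d, a < r -> b < r -> a <= b -> rect_integral f a b c d = 0%C).
  { clear a b c d. intros a b c d Ha Hb Hab. destruct (Rle_lt_dec c d).
    - apply goursat; auto. intros; apply Hd; lra.
    - transitivity (- rect_integral f a b d c)%C.
      + unfold rect_integral.
        rewrite (CInt_swap (fun s => f (b, s)) c d) by now apply continuous_along_ver.
        rewrite (CInt_swap (fun s => f (a, s)) c d) by now apply continuous_along_ver.
        ring.
      + rewrite goursat; auto; try lra; try ring. intros; apply Hd; lra. }
  intros Ha Hb. destruct (Rle_lt_dec a b); auto.
  transitivity (- rect_integral f b a c d)%C.
  - unfold rect_integral.
    rewrite (CInt_swap (fun s => f (s, c)) a b) by now apply continuous_along_hor.
    rewrite (CInt_swap (fun s => f (s, d)) a b) by now apply continuous_along_hor.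
    ring.
  - rewrite K by lra. ring.
Qed.

Lemma CInt_const (k : C) (a b : R) : CInt (fun _ => k) a b = (k * (b - a))%C.
Proof.
  rewrite (CInt_unique (fun _ => k) (fun t => k * t)%C).
  - ring.
  - intros; apply continuous_const.
  - intros t. eapply slope_limit_eq.
    + apply slope_limit_scal; [apply continuous_RtoC|apply slope_limit_id].
    + apply Cmult_1_r.
Qed.

Lemma CInt_near_const (f : R -> C) (k : C) (a b e : R) : (forall t, continuous f t) ->
  (forall t, Rmin a b <= t <= Rmax a b -> Cmod (f t - k) <= e) ->
  Cmod (CInt f a b - k * (b - a)) <= e * Rabs (b - a).
Proof.
  intros Hf H.
  assert (Hg : forall t, continuous (fun t => f t - k)%C t).
  { intros t. apply continuous_Cminus; auto using continuous_const. }
  replace (CInt f a b - k * (b - a))%C with (CInt (fun t => f t - k)%C a b).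
  - now apply CInt_bound.
  - rewrite <- CInt_const.
    assert (E : CInt f a b = CInt (fun t => (f t - k) + k)%C a b).
    { apply (RInt_ext (V := C_R_CompleteNormedModule)). intros t _. 
      assert (F : (f t = f t - k + k)%C) by ring. exact F. }
    rewrite E, CInt_plus; auto; [|intros; apply continuous_const]. ring.
Qed.

Lemma between_near (x x' t : R) : Rmin x x' <= t <= Rmax x x' -> Rabs (t - x) <= Rabs (x' - x).
Proof.
  unfold Rmin, Rmax. destruct (Rle_dec x x'); intros H.
  - rewrite !Rabs_pos_eq; lra.
  - rewrite (Rabs_left1 (x' - x)) by lra. rewrite Rabs_left1; lra.
Qed.

(** Integrating along a horizontal and then a vertical segment gives a primitive:
    by Goursat the same value is reached from a nearby point by going round
    a small corner, along which the function is almost constant. *)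
Lemma half_plane_primitive (f : C -> C) (r : R) : (forall z, continuous f z) ->
  (forall z : C, fst z < r -> exists l, cderiv f z l) ->
  exists P, forall z : C, fst z < r -> cderiv P z (f z).
Proof.
  intros Hf Hd.
  exists (fun z : C => CInt (fun s => f (s, 0)) (r - 1) (fst z) +
               Ci * CInt (fun s => f (fst z, s)) 0 (snd z))%C.
  intros z Hz. apply eps_slope_limit; [auto|]. intros e He. apply locally_C_eps.
  assert (He2 : 0 < e / 2) by lra.
  destruct (proj1 (continuous_CC f z) (Hf z) _ He2) as [d [Hdp H]].
  exists (Rmin (d / 2) (r - fst z)). split; [apply Rmin_pos; lra|].
  intros w Hw.
  pose proof (Rmin_l (d / 2) (r - fst z)). pose proof (Rmin_r (d / 2) (r - fst z)).
  pose proof (Rabs_fst_le (w - z)) as N1. pose proof (Rabs_snd_le (w - z)) as N2.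
  destruct z as [x y], w as [x' y']. simpl in N1, N2, Hz. cbn [fst snd] in *.
  fold (x' - x) in N1. fold (y' - y) in N2.
  assert (Hx' : x' < r). { pose proof (Rle_abs (x' - x)). lra. }
  pose proof (goursat_signed f r x x' 0 y Hf Hd Hz Hx') as G.
  unfold rect_integral in G.
  assert (E : (CInt (fun s => f (s, 0)) (r - 1) x' + Ci * CInt (fun s => f (x', s)) 0 y'
     - (CInt (fun s => f (s, 0)) (r - 1) x + Ci * CInt (fun s => f (x, s)) 0 y)
     = CInt (fun s => f (s, y)) x x' + Ci * CInt (fun s => f (x', s)) y y')%C).
  { rewrite <- (CInt_Chasles (fun s => f (s, 0)) (r - 1) x x') by now apply continuous_along_hor.
    rewrite <- (CInt_Chasles (fun s => f (x', s)) 0 y y') by now apply continuous_along_ver.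
    match type of G with ?u = _ => transitivity (u + (CInt (fun s => f (s, y)) x x' + Ci * CInt (fun s => f (x', s)) y y'))%C end.
    - ring.
    - rewrite G. ring. }
  rewrite E.
  assert (B1 := CInt_near_const (fun s => f (s, y)) (f (x, y)) x x' (e / 2)
    (continuous_along_hor f Hf y)).
  assert (B2 := CInt_near_const (fun s => f (x', s)) (f (x, y)) y y' (e / 2)
    (continuous_along_ver f Hf x')).
  assert (Z : forall s t, Rabs (s - x) <= Rabs (x' - x) -> Rabs (t - y) <= Rabs (y' - y) ->
     Cmod (f (s, t) - f (x, y)) <= e / 2).
  { intros s t Hs Ht. apply Rlt_le, H. eapply Rle_lt_trans; [apply Cmod_le_sum|]. simpl.
    unfold Rminus in *. lra. }
  assert (B1' := B1 (fun t Ht => Z t y (between_near _ _ _ Ht)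
     ltac:(rewrite Rminus_diag, Rabs_R0; apply Rabs_pos))).
  assert (B2' := B2 (fun t Ht => Z x' t (Rle_refl _) (between_near _ _ _ Ht))).
  match goal with |- Cmod ?u <= _ => replace u with
    ((CInt (fun s => f (s, y)) x x' - f (x, y) * (x' - x))
      + Ci * (CInt (fun s => f (x', s)) y y' - f (x, y) * (y' - y)))%C end.
  - eapply Rle_trans; [apply Cmod_triangle|]. rewrite Cmod_mult, Cmod_Ci.
    pose proof (Rmult_le_compat_l (e / 2) _ _ ltac:(lra) N1).
    pose proof (Rmult_le_compat_l (e / 2) _ _ ltac:(lra) N2). lra.
  - replace ((x', y') - (x, y))%C with ((x' - x) + Ci * (y' - y))%C; [ring|].
    unfold Cminus, Ci, Cplus, Cmult, Copp, RtoC; simpl. f_equal; ring.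
Qed.

(** * The exponential and logarithmic coordinates *)

Definition Cexp (w : C) : C := (exp (fst w) * cos (snd w), exp (fst w) * sin (snd w)).

Lemma Cexp_plus (w v : C) : Cexp (w + v) = (Cexp w * Cexp v)%C.
Proof.
  unfold Cexp, Cmult, Cplus; simpl. rewrite exp_plus, cos_plus, sin_plus.
  f_equal; ring.
Qed.

Lemma Cexp_0 : Cexp 0 = 1%C.
Proof. unfold Cexp, RtoC; simpl. rewrite exp_0, cos_0, sin_0. f_equal; ring. Qed.

Lemma Cmod_Cexp (w : C) : Cmod (Cexp w) = exp (fst w).
Proof.
  pose proof (exp_pos (fst w)) as He.
  apply Rsqr_inj; [apply Cmod_ge_0|lra|]. unfold Rsqr. rewrite Cmod_sqr.
  unfold Cexp; simpl. pose proof (sin2_cos2 (snd w)) as H. unfold Rsqr in H.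
  transitivity (exp (fst w) * exp (fst w) * (sin (snd w) * sin (snd w) + cos (snd w) * cos (snd w))).
  - ring.
  - rewrite H. ring.
Qed.

Lemma Cexp_neq_0 (w : C) : Cexp w <> 0%C.
Proof. apply Cmod_gt_0. rewrite Cmod_Cexp. apply exp_pos. Qed.

Definition two_pi_i : C := (0, 2 * PI).

Lemma Cexp_period (w : C) : Cexp (w + two_pi_i) = Cexp w.
Proof.
  rewrite Cexp_plus. replace (Cexp two_pi_i) with (RtoC 1); [ring|].
  unfold Cexp, two_pi_i, RtoC; simpl. rewrite exp_0, cos_2PI, sin_2PI. f_equal; ring.
Qed.

Lemma continuous_Cexp (w : C) : continuous Cexp w.
Proof.
  assert (H : forall (g : R -> R), (forall x, ex_derive g x) -> forall (h : C -> R) (z : C),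
    continuous h z -> continuous (fun z => g (h z)) z).
  { intros g Hg h z Hh. apply (continuous_comp h g); auto.
    apply (ex_derive_continuous (V := R_NormedModule)). apply Hg. }
  apply continuous_pair; apply (continuous_mult (K := R_AbsRing));
  apply H; intros; try apply continuous_fstC; try apply continuous_sndC; auto_derive; auto.
Qed.

Lemma vderiv_Cexp_ray (h : C) (t : R) :
  vderiv (fun s : R => Cexp (s * h)%C) t (h * Cexp (t * h))%C.
Proof.
  apply is_derive_vderiv; simpl; auto_derive; auto; unfold Rminus; ring.
Qed.

Lemma cderiv_Cexp_0 : cderiv Cexp (RtoC 0) (RtoC 1).
Proof.
  apply eps_slope_limit; [auto|]. intros e He. apply locally_C_eps.
  destruct (proj1 (continuous_CC Cexp (RtoC 0)) (continuous_Cexp (RtoC 0)) e He) as [d [Hd H]].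
  exists d. split; auto. intros h Hh.
  replace (h - 0)%C with h in * by ring. rewrite Cexp_0.
  assert (M := mean_value_inequality (fun s : R => Cexp (s * h) - s * h)%C
     (fun s : R => h * Cexp (s * h) - 1 * h)%C 0 1 (e * Cmod h) ltac:(lra)). cbv beta in M.
  replace (Cexp (1 * h) - 1 * h - (Cexp (0 * h) - 0 * h))%C
    with (Cexp h - 1 - 1 * h)%C in M.
  - rewrite Rminus_0_r, Rmult_1_r in M. apply M. intros t Ht. split.
    + apply slope_limit_minus; [apply continuous_RtoC|apply vderiv_Cexp_ray|].
      eapply slope_limit_eq.
      * apply slope_limit_mult; [apply continuous_RtoC|apply slope_limit_id|apply slope_limit_const].
      * cbv beta. ring.
    + replace (h * Cexp (t * h) - 1 * h)%C with ((Cexp (t * h) - Cexp 0) * h)%C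
        by (rewrite Cexp_0; ring).
      rewrite Cmod_mult. apply Rmult_le_compat_r; [apply Cmod_ge_0|].
      apply Rlt_le, H. replace (t * h - 0)%C with (t * h)%C by ring.
      rewrite Cmod_mult, Cmod_R, Rabs_pos_eq by lra.
      pose proof (Cmod_ge_0 h). nra.
  - replace (1 * h)%C with h by ring. replace (0 * h)%C with (RtoC 0) by ring.
    rewrite Cexp_0. ring.
Qed.

Lemma cderiv_Cexp (w : C) : cderiv Cexp w (Cexp w).
Proof.
  destruct cderiv_Cexp_0 as [q [Hq [Hq0 E]]].
  exists (fun v => Cexp w * q (v - w))%C. repeat split.
  - apply continuous_Cmult; [apply continuous_const|].
    apply (continuous_comp (fun v : C => v - w)%C q).
    + apply continuous_Cminus; [apply continuous_id|apply continuous_const].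
    + replace (w - w)%C with (RtoC 0) by ring. exact Hq.
  - replace (w - w)%C with (RtoC 0) by ring. rewrite Hq0. ring.
  - intros v. replace v with (w + (v - w))%C at 1 by ring.
    rewrite Cexp_plus, (E (v - w)%C), Cexp_0. ring.
Qed.

(** In a function that is [2 pi i]-periodic the primitive is periodic up to an
    additive constant, and the constant vanishes because the function is small
    far to the left. *)
Lemma periodic_primitive (k : C -> C) (r : R) : (forall z, continuous k z) ->
  (forall z : C, fst z < r -> exists l, cderiv k z l) ->
  (forall z, k (z + two_pi_i)%C = k z) ->
  (forall e, 0 < e -> exists s, forall z : C, fst z < s -> Cmod (k z) <= e) ->
  exists J, (forall z : C, fst z < r -> cderiv J z (k z)) /\
    (forall z : C, fst z < r -> J (z + two_pi_i)%C = J z).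
Proof.
  intros Hk Hd Hp Hlim.
  destruct (half_plane_primitive k r Hk Hd) as [J HJ]. exists J. split; auto.
  intros z Hz. set (g := fun w : C => (J (w + two_pi_i) - J w)%C).
  assert (Hfst : forall w, fst (w + two_pi_i)%C = fst w) by (intros w; simpl; ring).
  assert (Hg : forall w : C, fst w < r -> cderiv g w 0%C).
  { intros w Hw. eapply slope_limit_eq.
    - apply slope_limit_minus; [apply continuous_idC| |now apply HJ].
      apply (slope_limit_comp (T := C_UniformSpace) (fun w : C => w) (fun w : C => w + two_pi_i)%C J).
      + apply continuous_idC.
      + apply slope_limit_plus; [apply slope_limit_id|apply slope_limit_const].
      + apply HJ. now rewrite Hfst.
    - rewrite Hp. ring. }
  assert (Hc : forall x, x <= fst z -> g (x, snd z) = g z).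
  { intros x Hx. replace z with ((fst z, snd z) : C) at 2 by now destruct z.
    assert (M := mean_value_inequality (fun s : R => g (s, snd z)) (fun _ => RtoC 0)
      x (fst z) 0 Hx). cbv beta in M.
    assert (E : (g (fst z, snd z) - g (x, snd z) = 0)%C).
    { apply Cmod_eq_0, Rle_antisym; [|apply Cmod_ge_0].
      eapply Rle_trans; [apply M|lra]. intros t Ht. split.
      - eapply slope_limit_eq.
        + apply (slope_limit_comp (T := R_UniformSpace) RtoC (fun s : R => (s, snd z) : C) g).
          * apply continuous_RtoC.
          * apply vderiv_hor.
          * apply Hg. simpl. lra.
        + ring.
      - rewrite Cmod_0. lra. }
    replace (g (fst z, snd z)) with ((g (fst z, snd z) - g (x, snd z)) + g (x, snd z))%C by ring.
    rewrite E. ring. }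
  assert (H0 : g z = 0%C).
  { apply Cmod_eq_0, Rle_antisym; [|apply Cmod_ge_0].
    apply le_epsilon. intros e He. rewrite Rplus_0_l.
    assert (HPI := PI_RGT_0).
    destruct (Hlim (e / (2 * PI))) as [s Hs]; [apply Rdiv_lt_0_compat; lra|].
    set (x := Rmin (fst z) (s - 1)).
    pose proof (Rmin_l (fst z) (s - 1)); pose proof (Rmin_r (fst z) (s - 1)). fold x in H, H0.
    rewrite <- (Hc x) by auto. unfold g.
    assert (M := mean_value_inequality (fun t : R => J (x, snd z + t)) 
      (fun t => k (x, snd z + t)%R * Ci)%C 0 (2 * PI) (e / (2 * PI)) ltac:(lra)). cbv beta in M.
    replace ((x, snd z) + two_pi_i)%C with ((x, snd z + 2 * PI) : C)
      by (unfold two_pi_i, Cplus; simpl; f_equal; ring).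
    rewrite Rplus_0_r in M.
    eapply Rle_trans; [apply M|].
    - intros t Ht. split.
      + apply (slope_limit_comp (T := R_UniformSpace) RtoC (fun s : R => (x, snd z + s) : C) J).
        * apply continuous_RtoC.
        * apply is_derive_vderiv; simpl; auto_derive; auto; ring.
        * apply HJ. simpl. lra.
      + rewrite Cmod_mult, Cmod_Ci, Rmult_1_r. apply Hs. simpl. lra.
    - right. field. lra. }
  unfold g in H0. replace (J (z + two_pi_i)%C) with ((J (z + two_pi_i) - J z) + J z)%C by ring.
  rewrite H0. ring.
Qed.

Lemma cderiv_of_entire (F : C -> C) : entire F -> forall z, exists l, cderiv F z l.
Proof. intros H z. destruct (H z) as [l Hl]. exists l. now apply is_derive_C_C. Qed.

(** In the coordinate [w], [z = a + exp w], the difference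
    quotient minus its limit satisfies the hypotheses of [periodic_primitive];
    hence the difference quotient has mean value [l] over the unit circle, and its
    modulus is at most [2 * B] there. *)
Lemma cauchy_estimate (F : C -> C) (a l : C) (B : R) :
  (forall z, exists m, cderiv F z m) -> cderiv F a l ->
  (forall z, Cmod (z - a) = 1 -> Cmod (F z) <= B) -> Cmod (F a) <= B ->
  Cmod l <= 2 * B.
Proof.
  intros HF Ha HB HBa.
  set (quot := fun w : C => ((F (a + Cexp w) - F a) * / Cexp w)%C).
  set (k := fun w : C => (quot w - l)%C).
  assert (Hk : forall z, exists m, cderiv k z m).
  { intros z. destruct (HF (a + Cexp z)%C) as [m Hm]. eexists.
    apply slope_limit_minus; [apply continuous_idC| |apply slope_limit_const].
    apply slope_limit_mult; [apply continuous_idC| |].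
    - apply slope_limit_minus; [apply continuous_idC| |apply slope_limit_const].
      apply (slope_limit_comp (T := C_UniformSpace) (fun w : C => w) (fun w : C => a + Cexp w)%C F);
        [apply continuous_idC| |exact Hm].
      apply slope_limit_plus; [apply slope_limit_const|apply cderiv_Cexp].
    - apply slope_limit_inv; [apply continuous_idC|apply Cexp_neq_0|apply cderiv_Cexp]. }
  destruct (periodic_primitive k 1) as [J [HJ HJp]].
  - intros z. destruct (Hk z) as [m Hm]. exact (cderiv_continuous _ _ _ Hm).
  - intros z _. apply Hk.
  - intros z. unfold k, quot. now rewrite Cexp_period.
  - intros e He. pose proof (slope_limit_eps _ _ _ _ Ha e He) as H.
    apply locally_C_eps in H. destruct H as [d [Hd H]].
    exists (ln d). intros z Hz.
    assert (Hex : Cmod (Cexp z) < d).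
    { rewrite Cmod_Cexp, <- (exp_ln d) by auto. now apply exp_increasing. }
    specialize (H (a + Cexp z)%C). replace (a + Cexp z - a)%C with (Cexp z) in H by ring.
    specialize (H Hex). unfold k, quot.
    replace ((F (a + Cexp z) - F a) * / Cexp z - l)%C
      with ((F (a + Cexp z) - F a - l * Cexp z) / Cexp z)%C
      by (field; apply Cexp_neq_0).
    rewrite Cmod_div by apply Cexp_neq_0.
    assert (0 < Cmod (Cexp z)) by (rewrite Cmod_Cexp; apply exp_pos).
    apply Rmult_le_reg_r with (Cmod (Cexp z)); auto.
    unfold Rdiv. rewrite Rmult_assoc, Rinv_l, Rmult_1_r by lra. exact H.
  - assert (HPI := PI_RGT_0).
    assert (M := mean_value_inequality
      (fun t : R => J (0, t) + l * Ci * t)%C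
      (fun t : R => k (0, t) * Ci + l * Ci * 1)%C 0 (2 * PI) (2 * B) ltac:(lra)). cbv beta in M.
    assert (E : (J (0, 2 * PI)%R + l * Ci * (2 * PI)%R - (J (0, 0)%R + l * Ci * 0) = l * Ci * (2 * PI)%R)%C).
    { specialize (HJp (0, 0)). simpl in HJp.
      replace ((0, 0) + two_pi_i)%C with ((0, 2 * PI) : C) in HJp
        by (unfold two_pi_i, Cplus; simpl; f_equal; ring).
      rewrite HJp by lra. ring. }
    rewrite E in M. rewrite !Cmod_mult, Cmod_Ci, Cmod_R, Rabs_pos_eq in M by lra.
    apply Rmult_le_reg_r with (2 * PI); [lra|].
    replace (2 * B * (2 * PI)) with (2 * B * (2 * PI - 0)) by ring.
    replace (Cmod l * (2 * PI)) with (Cmod l * 1 * (2 * PI)) by ring.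
    apply M. intros t Ht. split.
    + apply slope_limit_plus.
      * apply (slope_limit_comp (T := R_UniformSpace) RtoC (fun s : R => (0, s) : C) J).
        -- apply continuous_RtoC.
        -- apply vderiv_ver.
        -- apply HJ. simpl. lra.
      * apply slope_limit_scal; [apply continuous_RtoC|apply slope_limit_id].
    + replace (k (0, t) * Ci + l * Ci * 1)%C with (quot (0, t) * Ci)%C
        by (unfold k; ring).
      rewrite Cmod_mult, Cmod_Ci, Rmult_1_r. unfold quot.
      assert (C1 : Cmod (Cexp (0, t)) = 1) by (rewrite Cmod_Cexp; apply exp_0).
      rewrite Cmod_mult, Cmod_inv, C1, Rinv_1, Rmult_1_r by apply Cexp_neq_0.
      eapply Rle_trans; [apply Cmod_triangle|]. rewrite Cmod_opp.
      assert (Cmod (F (a + Cexp (0, t))%C) <= B); [|lra].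
      apply HB. replace (a + Cexp (0, t) - a)%C with (Cexp (0, t)) by ring. exact C1.
Qed.

(** Differentiability alone gives no local bound on the derivative; the bound
    comes from Cauchy's estimate on unit circles, which is why [F] is first bounded
    on the disc of radius [r + 1]. *)
Lemma entire_lipschitz (F : C -> C) (r : R) : (forall z, exists m, cderiv F z m) ->
  exists M, 0 <= M /\ forall z w, Cmod z <= r -> Cmod w <= r ->
    Cmod (F z - F w) <= M * Cmod (z - w).
Proof.
  intros HF.
  destruct (continuous_bounded F (r + 1)) as [B HB].
  { intros z. destruct (HF z) as [m Hm]. exact (cderiv_continuous _ _ _ Hm). }
  exists (Rmax 0 (2 * B)). split; [apply Rmax_l|]. intros z w Hz Hw.
  pose (dF := fun z => proj1_sig (constructive_indefinite_description _ (HF z))).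
  assert (HdF : forall z, cderiv F z (dF z)).
  { intros u. unfold dF. now destruct constructive_indefinite_description. }
  assert (M := mean_value_inequality (fun t : R => F (w + t * (z - w)))%C
    (fun t : R => dF (w + t * (z - w)) * (1 * (z - w)))%C 0 1
    (2 * B * Cmod (z - w)) ltac:(lra)). cbv beta in M.
  replace (w + 1 * (z - w))%C with z in M by ring.
  replace (w + 0 * (z - w))%C with w in M by ring.
  eapply Rle_trans; [apply M|].
  - intros t Ht. split.
    + apply (slope_limit_comp (T := R_UniformSpace) RtoC (fun t : R => w + t * (z - w))%C F).
      * apply continuous_RtoC.
      * eapply slope_limit_eq.
        -- apply slope_limit_plus; [apply slope_limit_const|].
           apply slope_limit_mult; [apply continuous_RtoC|apply slope_limit_id|apply slope_limit_const].
        -- cbv beta. ring.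
      * apply HdF.
    + rewrite !Cmod_mult, Cmod_1, Rmult_1_l.
      apply Rmult_le_compat_r; [apply Cmod_ge_0|].
      assert (Hm : Cmod (w + t * (z - w)) <= r).
      { replace (w + t * (z - w))%C with ((1 - t)%R * w + t * z)%C
          by (rewrite RtoC_minus; ring).
        eapply Rle_trans; [apply Cmod_triangle|].
        rewrite !Cmod_mult, !Cmod_R, !Rabs_pos_eq by lra.
        pose proof (Rmult_le_compat_l (1 - t) _ _ ltac:(lra) Hw).
        pose proof (Rmult_le_compat_l t _ _ ltac:(lra) Hz). lra. }
      apply cauchy_estimate with F (w + t * (z - w))%C; auto.
      * intros u Hu. apply HB.
        replace u with ((u - (w + t * (z - w))) + (w + t * (z - w)))%C by ring.
        eapply Rle_trans; [apply Cmod_triangle|lra].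
      * apply HB. lra.
  - rewrite Rminus_0_r, Rmult_1_r. apply Rmult_le_compat_r; [apply Cmod_ge_0|apply Rmax_r].
Qed.

(** * Estimates along trajectories *)

Definition trajectory (F : C -> C) (f : R -> C) (s t : R) : Prop :=
  forall u, s <= u <= t -> vderiv f u (F (f u)).

Lemma trajectory_sub F f s t s' t' : s <= s' -> t' <= t ->
  trajectory F f s t -> trajectory F f s' t'.
Proof. intros H1 H2 H u Hu. apply H. lra. Qed.

Lemma trajectory_const (F : C -> C) (a : C) (s t : R) : F a = RtoC 0 -> trajectory F (fun _ => a) s t.
Proof. intros Ha u _. rewrite Ha. apply slope_limit_const. Qed.

Lemma is_derive_sqnorm (f : R -> C) (t : R) (v : C) : vderiv f t v ->
  is_derive (fun s => dot (f s) (f s)) t (2 * dot (f t) v).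
Proof.
  intros H. apply vderiv_is_derive in H. destruct H as [H1 H2]. unfold dot.
  replace (2 * (fst (f t) * fst v + snd (f t) * snd v)) with
   ((fst v * fst (f t) + fst (f t) * fst v) + (snd v * snd (f t) + snd (f t) * snd v)) by ring.
  apply (is_derive_plus (V := R_NormedModule)).
  - apply (is_derive_mult (fun s => fst (f s)) (fun s => fst (f s))); auto. apply Rmult_comm.
  - apply (is_derive_mult (fun s => snd (f s)) (fun s => snd (f s))); auto. apply Rmult_comm.
Qed.

Lemma exp_le_compat (x y : R) : x <= y -> exp x <= exp y.
Proof. intros [H| ->]; [apply Rlt_le; now apply exp_increasing|lra]. Qed.

Lemma derive_gronwall (g dg : R -> R) (s t k : R) : s <= t ->
  (forall u, s <= u <= t -> is_derive g u (dg u) /\ dg u <= k * g u) ->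
  g t <= g s * exp (k * (t - s)).
Proof.
  intros Hst H.
  assert (K := derive_le_increment (fun u => g u * exp (- k * (u - s)))
    (fun u => dg u * exp (- k * (u - s)) + g u * (- k * exp (- k * (u - s)))) s t 0 Hst).
  cbv beta in K.
  assert (K' : g t * exp (- k * (t - s)) - g s * exp (- k * (s - s)) <= 0 * (t - s)).
  { apply K. intros u Hu. destruct (H u Hu) as [H1 H2]. split.
    - apply (is_derive_mult g (fun u => exp (- k * (u - s)))); [exact H1| |apply Rmult_comm].
      auto_derive; auto. unfold Rminus. ring.
    - pose proof (exp_pos (- k * (u - s))). nra. }
  replace (- k * (s - s)) with 0 in K' by ring. rewrite exp_0 in K'.
  replace (- k * (t - s)) with (- (k * (t - s))) in K' by ring.
  rewrite exp_Ropp in K'.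
  pose proof (exp_pos (k * (t - s))) as Hp.
  apply Rmult_le_reg_r with (/ exp (k * (t - s))).
  - now apply Rinv_0_lt_compat.
  - rewrite (Rmult_assoc (g s)), Rinv_r by lra. lra.
Qed.

Lemma derive_gronwall_back (g dg : R -> R) (s t k : R) : s <= t ->
  (forall u, s <= u <= t -> is_derive g u (dg u) /\ - k * g u <= dg u) ->
  g s <= g t * exp (k * (t - s)).
Proof.
  intros Hst H.
  assert (K := derive_gronwall (fun u => g (- u)) (fun u => - dg (- u)) (- t) (- s) k).
  cbv beta in K. rewrite !Ropp_involutive in K.
  replace (- s - - t) with (t - s) in K by ring. apply K; [lra|].
  intros u Hu. destruct (H (- u)) as [H1 H2]; [lra|]. split; [|lra].
  replace (- dg (- u)) with (-1 * dg (- u)) by ring.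
  apply (is_derive_comp g Ropp); auto. auto_derive; auto.
Qed.

Lemma sqr_exp_le (x y k : R) : 0 <= y -> x * x <= y * y * exp (2 * k) -> x <= y * exp k.
Proof.
  intros Hy H. pose proof (exp_pos k) as Hk. apply Rsqr_incr_0_var.
  - unfold Rsqr. replace (2 * k) with (k + k) in H by ring. rewrite exp_plus in H.
    eapply Rle_trans; [exact H|]. right. ring.
  - apply Rmult_le_pos; lra.
Qed.

Lemma Rabs_dot_le (u v : C) : Rabs (dot u v) <= Cmod u * Cmod v.
Proof.
  apply Rabs_le. split; [|apply dot_le].
  pose proof (dot_le u (- v)%C) as H. rewrite Cmod_opp in H.
  replace (dot u (- v)%C) with (- dot u v) in H by (unfold dot; simpl; ring). lra.
Qed.

(** The derivative of the squared distance is at most [2 * M] times that distance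
    in absolute value, so the distance can neither grow nor shrink faster than
    exponentially. The second bound is what keeps a trajectory from reaching an
    equilibrium in finite time. *)
Lemma trajectories_diverge (F : C -> C) (f g : R -> C) (s t M : R) : s <= t ->
  trajectory F f s t -> trajectory F g s t ->
  (forall u, s <= u <= t -> Cmod (F (f u) - F (g u)) <= M * Cmod (f u - g u)) ->
  Cmod (f t - g t) <= Cmod (f s - g s) * exp (M * (t - s)) /\
  Cmod (f s - g s) <= Cmod (f t - g t) * exp (M * (t - s)).
Proof.
  intros Hst Hf Hg HM. set (h := fun u => (f u - g u)%C).
  assert (D : forall u, s <= u <= t ->
    is_derive (fun u => dot (h u) (h u)) u (2 * dot (h u) (F (f u) - F (g u))%C) /\
    Rabs (2 * dot (h u) (F (f u) - F (g u))%C) <= 2 * M * dot (h u) (h u)).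
  { intros u Hu. split.
    - apply is_derive_sqnorm. apply slope_limit_minus; auto using continuous_RtoC.
    - rewrite Rabs_mult, (Rabs_pos_eq 2) by lra. rewrite dot_self.
      pose proof (Rabs_dot_le (h u) (F (f u) - F (g u))%C).
      pose proof (HM u Hu) as L. fold (h u) in L.
      pose proof (Rmult_le_compat_l _ _ _ (Cmod_ge_0 (h u)) L). lra. }
  split; (apply sqr_exp_le; [apply Cmod_ge_0|]); fold (h s) (h t); rewrite <- !dot_self;
    rewrite <- Rmult_assoc.
  - apply (derive_gronwall (fun u => dot (h u) (h u)) (fun u => 2 * dot (h u) (F (f u) - F (g u))%C)); auto.
    intros u Hu. destruct (D u Hu) as [D1 D2]. split; auto.
    apply Rabs_le_between in D2. lra.
  - apply (derive_gronwall_back (fun u => dot (h u) (h u)) (fun u => 2 * dot (h u) (F (f u) - F (g u))%C)); auto.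
    intros u Hu. destruct (D u Hu) as [D1 D2]. split; auto.
    apply Rabs_le_between in D2. lra.
Qed.

Lemma continuous_Cmod {T : UniformSpace} (f : T -> C) (x : T) :
  continuous f x -> continuous (fun y => Cmod (f y)) x.
Proof.
  intros H. apply filterlim_locally. intros e.
  apply continuous_C with (e := e) in H; [|apply cond_pos].
  revert H. apply filter_imp. intros y Hy.
  change (Rabs (Cmod (f y) - Cmod (f x)) < e).
  eapply Rle_lt_trans; [|exact Hy]. apply Rabs_le.
  pose proof (Cmod_triangle (f y - f x) (f x)) as T1.
  replace (f y - f x + f x)%C with (f y) in T1 by ring.
  pose proof (Cmod_triangle (f x - f y) (f y)) as T2.
  replace (f x - f y + f y)%C with (f x) in T2 by ring.
  rewrite Cmod_sub_sym in T2. lra.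
Qed.

Lemma trajectory_bounded F f s t : s <= t -> trajectory F f s t ->
  exists B, forall u, s <= u <= t -> Cmod (f u) <= B.
Proof.
  intros Hst H.
  destruct (continuity_ab_maj (fun u => Cmod (f u)) s t Hst) as [m [Hm _]].
  - intros c Hc. apply continuity_pt_filterlim. apply (continuous_Cmod f).
    eapply vderiv_continuous. apply H, Hc.
  - now exists (Cmod (f m)).
Qed.

Section Flow.
Variable F : C -> C.
Hypothesis F_hol : forall z, exists l, cderiv F z l.

(** On a compact time interval both trajectories are bounded, and there [F] is
    Lipschitz. *)
Lemma trajectories_diverge_compact f g s t : s <= t ->
  trajectory F f s t -> trajectory F g s t ->
  exists M, 0 <= M /\ forall s' t', s <= s' -> s' <= t' -> t' <= t ->
  Cmod (f t' - g t') <= Cmod (f s' - g s') * exp (M * (t' - s')) /\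
  Cmod (f s' - g s') <= Cmod (f t' - g t') * exp (M * (t' - s')).
Proof.
  intros Hst Hf Hg.
  destruct (trajectory_bounded F f s t Hst Hf) as [B1 H1].
  destruct (trajectory_bounded F g s t Hst Hg) as [B2 H2].
  destruct (entire_lipschitz F (Rmax B1 B2) F_hol) as [M [HM H]].
  exists M. split; auto. intros s' t' h1 h2 h3.
  apply trajectories_diverge with F; auto.
  - now apply trajectory_sub with s t.
  - now apply trajectory_sub with s t.
  - intros u Hu. apply H.
    + eapply Rle_trans; [apply H1; lra|apply Rmax_l].
    + eapply Rle_trans; [apply H2; lra|apply Rmax_r].
Qed.

Lemma trajectory_unique_forward f g s t : s <= t ->
  trajectory F f s t -> trajectory F g s t -> f s = g s -> f t = g t.
Proof.
  intros Hst Hf Hg E.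
  destruct (trajectories_diverge_compact f g s t Hst Hf Hg) as [M [_ H]].
  destruct (H s t) as [H1 _]; try lra. rewrite E in H1.
  replace (g s - g s)%C with (RtoC 0) in H1 by ring. rewrite Cmod_0, Rmult_0_l in H1.
  assert (Z : (f t - g t = 0)%C) by (apply Cmod_eq_0, Rle_antisym; [lra|apply Cmod_ge_0]).
  replace (f t) with ((f t - g t) + g t)%C by ring. rewrite Z. ring.
Qed.

Lemma trajectory_unique_backward f g s t : s <= t ->
  trajectory F f s t -> trajectory F g s t -> f t = g t -> f s = g s.
Proof.
  intros Hst Hf Hg E.
  destruct (trajectories_diverge_compact f g s t Hst Hf Hg) as [M [_ H]].
  destruct (H s t) as [_ H1]; try lra. rewrite E in H1.
  replace (g t - g t)%C with (RtoC 0) in H1 by ring. rewrite Cmod_0, Rmult_0_l in H1.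
  assert (Z : (f s - g s = 0)%C) by (apply Cmod_eq_0, Rle_antisym; [lra|apply Cmod_ge_0]).
  replace (f s) with ((f s - g s) + g s)%C by ring. rewrite Z. ring.
Qed.

(** Continuous induction: as long as [u] has stayed below [e] it is strictly below. *)
Lemma bootstrap (u : R -> R) (s t e : R) :
  (forall x, s <= x <= t -> continuous u x) -> u s < e ->
  (forall x, s <= x <= t -> (forall y, s <= y <= x -> u y <= e) -> u x < e) ->
  forall x, s <= x <= t -> u x < e.
Proof.
  intros Hc Hs Hb x Hx. apply NNPP. intros Hn.
  assert (Hloc : forall y r, s <= y <= t -> u y < r -> exists d, 0 < d /\
     forall z, Rabs (z - y) < d -> u z < r).
  { intros y r Hy Hr. apply locally_R_eps.
    apply (Hc y Hy (fun v => v < r)). now apply open_lt. }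
  assert (Hloc2 : forall y r, s <= y <= t -> r < u y -> exists d, 0 < d /\
     forall z, Rabs (z - y) < d -> r < u z).
  { intros y r Hy Hr. apply locally_R_eps.
    apply (Hc y Hy (fun v => r < v)). now apply open_gt. }
  set (E := fun y => s <= y <= x /\ forall z, s <= z <= y -> u z <= e).
  destruct (completeness E) as [m [Hm1 Hm2]].
  - exists x. intros y Hy. apply Hy.
  - exists s. split; [lra|]. intros z Hz. replace z with s by lra. lra.
  - assert (Hms : s <= m).
    { apply Hm1. split; [lra|]. intros z Hz. replace z with s by lra. lra. }
    assert (Hmx : m <= x) by (apply Hm2; intros y Hy; apply Hy).
    assert (Hbelow : forall z, s <= z < m -> u z <= e).
    { intros z Hz. apply NNPP. intros Hne.
      assert (m <= z); [|lra]. apply Hm2. intros y [Hy1 Hy2].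
      apply Rnot_lt_le. intros Hlt. apply Hne, Hy2. lra. }
    assert (Hat : u m <= e).
    { apply Rnot_lt_le. intros Hlt.
      destruct (Rle_lt_or_eq_dec s m Hms) as [h|h].
      2:{ subst m. lra. }
      destruct (Hloc2 m e) as [d [Hd Hz]]; [lra|auto|].
      set (z := Rmax s (m - d / 2)).
      assert (Hzz : s <= z < m /\ m - d / 2 <= z).
      { split; [split; [apply Rmax_l|apply Rmax_lub_lt; lra]|apply Rmax_r]. }
      assert (u z <= e) by (apply Hbelow; lra).
      assert (e < u z); [|lra]. apply Hz. apply Rabs_def1; lra. }
    assert (Hlt : u m < e).
    { apply Hb; [lra|]. intros y Hy. destruct (Rle_lt_or_eq_dec y m (proj2 Hy)) as [h|h].
      - apply Hbelow. lra.
      - now subst y. }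
    assert (Hmx' : m < x).
    { destruct (Rle_lt_or_eq_dec m x Hmx) as [h|h]; auto. subst m. tauto. }
    destruct (Hloc m e) as [d [Hd Hz]]; [lra|auto|].
    set (y := Rmin x (m + d / 2)).
    assert (Hy : m < y <= x /\ y <= m + d / 2).
    { split; [split; [apply Rmin_glb_lt; lra|apply Rmin_l]|apply Rmin_r]. }
    assert (y <= m); [|lra]. apply Hm1. split; [lra|]. intros z Hzz.
    destruct (Rlt_le_dec z m).
    + apply Hbelow. lra.
    + apply Rlt_le, Hz. apply Rabs_def1; lra.
Qed.

Lemma trajectory_dist_continuous f g s t : trajectory F f s t -> trajectory F g s t ->
  forall x, s <= x <= t -> continuous (fun u => Cmod (f u - g u)) x.
Proof.
  intros Hf Hg x Hx. apply (continuous_Cmod (fun u => f u - g u)%C).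
  apply continuous_Cminus; eapply vderiv_continuous; [apply Hf|apply Hg]; auto.
Qed.

(** The Lipschitz constant is only available in a unit neighbourhood of the given
    trajectory; [bootstrap] shows that a trajectory starting close enough does not
    leave that neighbourhood. *)
Lemma continuous_dependence f t e : 0 <= t -> trajectory F f 0 t -> 0 < e ->
  exists d, 0 < d /\ forall g, trajectory F g 0 t -> Cmod (g 0 - f 0) < d ->
    forall u, 0 <= u <= t -> Cmod (g u - f u) < e.
Proof.
  intros Ht Hf He.
  destruct (trajectory_bounded F f 0 t Ht Hf) as [B HB].
  destruct (entire_lipschitz F (B + 1) F_hol) as [M [HM H]].
  set (e' := Rmin e 1).
  assert (He' : 0 < e') by (apply Rmin_pos; lra).
  pose proof (Rmin_l e 1) as E1. pose proof (Rmin_r e 1) as E2. fold e' in E1, E2.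
  pose proof (exp_pos (M * t)) as Hexp.
  assert (Hexp1 : 1 <= exp (M * t)).
  { rewrite <- exp_0. apply exp_le_compat. now apply Rmult_le_pos. }
  exists (e' / exp (M * t)). split; [now apply Rdiv_lt_0_compat|].
  intros g Hg Hd u Hu.
  apply Rlt_le_trans with e'; auto. revert u Hu.
  apply bootstrap with (u := fun u => Cmod (g u - f u)).
  - now apply trajectory_dist_continuous.
  - eapply Rlt_le_trans; [exact Hd|]. apply Rmult_le_reg_r with (exp (M * t)); auto.
    unfold Rdiv. rewrite Rmult_assoc, Rinv_l by lra. nra.
  - intros x Hx Hle.
    destruct (trajectories_diverge F g f 0 x M) as [K _]; try lra.
    + apply trajectory_sub with 0 t; auto; lra.
    + apply trajectory_sub with 0 t; auto; lra.
    + intros v Hv. specialize (HB v ltac:(lra)). specialize (Hle v Hv). apply H; [|lra].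
      replace (g v) with ((g v - f v) + f v)%C by ring.
      eapply Rle_trans; [apply Cmod_triangle|lra].
    + eapply Rle_lt_trans; [exact K|].
      apply Rle_lt_trans with (Cmod (g 0 - f 0) * exp (M * t)).
      * apply Rmult_le_compat_l; [apply Cmod_ge_0|].
        rewrite Rminus_0_r. apply exp_le_compat. apply Rmult_le_compat_l; lra.
      * apply Rmult_lt_reg_r with (/ exp (M * t)); [now apply Rinv_0_lt_compat|].
        rewrite Rmult_assoc, Rinv_r by lra. unfold Rdiv in Hd. lra.
Qed.

Variables (a l : C).
Hypothesis F_a : F a = 0%C.
Hypothesis F_l : cderiv F a l.

(** When [Re l < 0] the field points inwards on all small circles around [a]: the
    linear part contributes [Re l * |z - a| ^ 2] to half the derivative of the
    squared distance, and the remainder at most the opposite of that. *)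
Lemma trapping : fst l < 0 -> exists r, 0 < r /\ forall f s t, s <= t ->
  trajectory F f s t -> Cmod (f s - a) < r -> Cmod (f t - a) <= Cmod (f s - a).
Proof.
  intros Hl.
  pose proof (slope_limit_eps _ _ _ _ F_l (- fst l) ltac:(lra)) as H.
  apply locally_C_eps in H. destruct H as [d [Hd H]].
  exists (d / 2). split; [lra|]. intros f s t Hst Hf Hs.
  assert (Hdec : forall x, s <= x <= t -> (forall y, s <= y <= x -> Cmod (f y - a) <= d / 2) ->
    Cmod (f x - a) <= Cmod (f s - a)).
  { intros x Hx Hy. apply Rsqr_incr_0_var; [|apply Cmod_ge_0].
    unfold Rsqr. rewrite <- !dot_self.
    assert (K := derive_le_increment (fun u => dot (f u - a)%C (f u - a)%C)
      (fun u => 2 * dot (f u - a)%C (F (f u) - 0)%C) s x 0 (proj1 Hx)).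
    cbv beta in K.
    assert (K' : dot (f x - a)%C (f x - a)%C - dot (f s - a)%C (f s - a)%C <= 0 * (x - s)); [|lra].
    apply K. intros u Hu. split.
    - apply is_derive_sqnorm with (f := fun u => (f u - a)%C).
      apply slope_limit_minus; [apply continuous_RtoC|apply Hf; lra|apply slope_limit_const].
    - specialize (H (f u)). specialize (Hy u Hu). rewrite F_a in H.
      specialize (H ltac:(lra)). set (z := (f u - a)%C) in *.
      set (err := (F (f u) - 0 - l * z)%C) in *.
      replace (F (f u) - 0)%C with (err + l * z)%C by (unfold err; ring).
      replace (dot z (err + l * z)%C) with (dot z err + fst l * dot z z)
        by (unfold dot; simpl; ring).
      pose proof (dot_le z err). rewrite dot_self.
      pose proof (Rmult_le_compat_l _ _ _ (Cmod_ge_0 z) H). lra. }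
  apply Hdec; [lra|]. intros y Hy. apply Rlt_le. revert y Hy.
  apply bootstrap with (u := fun u => Cmod (f u - a)); auto.
  - apply (trajectory_dist_continuous f (fun _ => a)); auto. now apply (trajectory_const F).
  - intros x Hx Hy. eapply Rle_lt_trans; [apply Hdec|]; auto.
Qed.

Lemma trajectory_neq_equilibrium f s t : s <= t -> trajectory F f s t ->
  f s <> a -> f t <> a.
Proof.
  intros Hst Hf Hs E. apply Hs.
  apply (trajectory_unique_backward f (fun _ => a) s t); auto. now apply (trajectory_const F).
Qed.

End Flow.

(** * Multipliers of attracting zeros *)

Definition clamp (c d t : R) : R := Rmax c (Rmin t d).

Lemma clamp_id c d t : c <= t <= d -> clamp c d t = t.
Proof. intros H. unfold clamp. rewrite Rmin_left, Rmax_right; lra. Qed.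

Lemma clamp_between c d t : c <= d -> c <= clamp c d t <= d.
Proof.
  intros H. unfold clamp. split; [apply Rmax_l|].
  apply Rmax_lub; [auto|apply Rmin_r].
Qed.

Lemma Rabs_Rmin_sub (x y d : R) : Rabs (Rmin x d - Rmin y d) <= Rabs (x - y).
Proof.
  unfold Rmin. destruct (Rle_dec x d), (Rle_dec y d);
  unfold Rabs; repeat destruct Rcase_abs; lra.
Qed.

Lemma Rabs_Rmax_sub (x y d : R) : Rabs (Rmax d x - Rmax d y) <= Rabs (x - y).
Proof.
  unfold Rmax. destruct (Rle_dec d x), (Rle_dec d y);
  unfold Rabs; repeat destruct Rcase_abs; lra.
Qed.

Lemma continuous_contraction (f : R -> R) (t : R) :
  (forall x y, Rabs (f x - f y) <= Rabs (x - y)) -> continuous f t.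
Proof.
  intros H. apply filterlim_locally. intros e. exists e. intros s Hs.
  change (Rabs (f s - f t) < e). eapply Rle_lt_trans; [apply H|exact Hs].
Qed.

Lemma continuous_Rmin_const (d t : R) : continuous (fun s => Rmin s d) t.
Proof. apply continuous_contraction. intros; apply Rabs_Rmin_sub. Qed.

Lemma continuous_clamp (c d t : R) : continuous (clamp c d) t.
Proof.
  apply continuous_contraction. intros. unfold clamp.
  eapply Rle_trans; [apply Rabs_Rmax_sub|apply Rabs_Rmin_sub].
Qed.

Lemma periodic_reduction (J : C -> C) (r : R) :
  (forall z : C, fst z < r -> J (z + two_pi_i)%C = J z) ->
  forall (n : nat) (w : C), fst w < r -> Rabs (snd w) <= 2 * PI * (INR n + 1) ->
  exists w' : C, fst w' = fst w /\ Rabs (snd w') <= 2 * PI /\ J w' = J w.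
Proof.
  intros HJ. assert (HPI := PI_RGT_0).
  induction n as [|n IH]; intros w Hw Hn.
  - exists w. simpl in Hn. repeat split; auto. lra.
  - rewrite S_INR in Hn.
    destruct (Rle_lt_dec (Rabs (snd w)) (2 * PI)) as [h|h].
    { exists w. auto. }
    destruct (Rle_lt_dec 0 (snd w)) as [p|p].
    + rewrite Rabs_pos_eq in Hn, h by auto.
      destruct (IH (fst w, snd w - 2 * PI)) as [w' [H1 [H2 H3]]]; simpl; auto.
      { rewrite Rabs_pos_eq; lra. }
      exists w'. repeat split; auto. rewrite H3.
      rewrite <- HJ by auto. f_equal. unfold two_pi_i, Cplus; simpl.
      destruct w; simpl; f_equal; ring.
    + rewrite Rabs_left in Hn, h by auto.
      destruct (IH (w + two_pi_i)%C) as [w' [H1 [H2 H3]]]; simpl.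
      * lra.
      * rewrite Rabs_left; lra.
      * simpl in H1. rewrite Rplus_0_r in H1. exists w'. repeat split; auto.
        rewrite H3. now apply HJ.
Qed.

Section Multiplier.
Variable F : C -> C.
Hypothesis F_hol : forall z, exists l, cderiv F z l.
Variables (a l : C).
Hypothesis F_a : F a = 0%C.
Hypothesis F_l : cderiv F a l.
Hypothesis l_neq_0 : l <> 0%C.

(** The radius [r] serves all [e] at once: inside it [F] has no other zero and the
    quotient is bounded, while it becomes small only close to [a]. *)
Lemma near_simple_zero : exists r, 0 < r /\ forall e, 0 < e -> exists d, 0 < d /\
  forall h : C, h <> 0%C -> Cmod h < r -> F (a + h)%C <> 0%C /\
    Cmod (l * h / F (a + h) - 1)%C <= 1 / 2 /\
    (Cmod h < d -> Cmod (l * h / F (a + h) - 1)%C <= e).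
Proof.
  assert (Hl : 0 < Cmod l) by now apply Cmod_gt_0.
  assert (K : forall e, 0 < e -> exists d, 0 < d /\ forall h : C, Cmod h < d ->
     Cmod (F (a + h) - l * h) <= e * Cmod h).
  { intros e He. pose proof (slope_limit_eps _ _ _ _ F_l e He) as H.
    apply locally_C_eps in H. destruct H as [d [Hd H]]. exists d. split; auto.
    intros h Hh. specialize (H (a + h)%C).
    replace (a + h - a)%C with h in H by ring. rewrite F_a in H.
    replace (F (a + h) - 0)%C with (F (a + h)) in H by ring. auto. }
  destruct (K (Cmod l / 3)) as [r [Hr H0]]; [lra|].
  exists r. split; auto. intros e He.
  destruct (K (e * (Cmod l / 2))) as [d [Hd H1]]; [nra|].
  exists d. split; auto. intros h Hh Hhr. specialize (H0 h Hhr).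
  assert (Hh0 : 0 < Cmod h) by now apply Cmod_gt_0.
  assert (Hlow : Cmod l * (2 / 3) * Cmod h <= Cmod (F (a + h))).
  { pose proof (Cmod_triangle (l * h - F (a + h)) (F (a + h))) as T.
    replace (l * h - F (a + h) + F (a + h))%C with (l * h)%C in T by ring.
    rewrite Cmod_sub_sym, Cmod_mult in T. lra. }
  assert (Hpos : 0 < Cmod (F (a + h))).
  { eapply Rlt_le_trans; [|exact Hlow]. apply Rmult_lt_0_compat; lra. }
  assert (Hn : F (a + h)%C <> 0%C) by now apply Cmod_gt_0.
  assert (Hq : Cmod (l * h / F (a + h) - 1) = Cmod (F (a + h) - l * h) / Cmod (F (a + h))).
  { replace (l * h / F (a + h) - 1)%C with ((l * h - F (a + h)) / F (a + h))%C by (field; auto).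
    rewrite Cmod_div by auto. now rewrite Cmod_sub_sym. }
  split; [auto|]. rewrite Hq. split.
  - apply Rmult_le_reg_r with (Cmod (F (a + h))); auto.
    unfold Rdiv at 1. rewrite Rmult_assoc, Rinv_l, Rmult_1_r by lra. lra.
  - intros Hhd. specialize (H1 h Hhd).
    apply Rmult_le_reg_r with (Cmod (F (a + h))); auto.
    unfold Rdiv at 1. rewrite Rmult_assoc, Rinv_l, Rmult_1_r by lra.
    eapply Rle_trans; [exact H1|]. rewrite (Rmult_assoc e).
    apply Rmult_le_compat_l; lra.
Qed.

(** In the coordinate [w] with [z = a + z0 * exp w] the equation becomes [w' = K w] with a
    [2 pi i]-periodic [K] that tends to [l] far to the left, and [J] makes
    [w + J w] a coordinate with constant velocity [l]. The bound on [J] uses that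
    its derivative is at most [1 / 2] and that, by periodicity, [w] may be moved
    to the strip [|Im w| <= 2 pi] without changing [J w]. *)
Lemma log_rectification : exists r, 0 < r /\ forall z0 : C, z0 <> 0%C -> Cmod z0 < r ->
  exists J : C -> C,
    (forall w : C, Cmod z0 * exp (fst w) < r ->
      cderiv J w (l * (z0 * Cexp w) / F (a + z0 * Cexp w) - 1)%C) /\
    (forall w : C, Cmod z0 * exp (fst w) < r ->
      Cmod (J w - J 0%C) <= / 2 * (Rabs (fst w) + 2 * PI)).
Proof.
  destruct near_simple_zero as [r0 [Hr0 Hnear]].
  exists (r0 / 2). split; [lra|]. intros z0 Hz0 Hz0r.
  assert (Hz0p : 0 < Cmod z0) by now apply Cmod_gt_0.
  set (c := ln (r0 / 2 / Cmod z0)).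
  assert (Hexpc : Cmod z0 * exp c = r0 / 2).
  { unfold c. rewrite exp_ln; [field; lra|]. apply Rdiv_lt_0_compat; lra. }
  assert (Hlt : forall x, Cmod z0 * exp x < r0 / 2 -> x < c).
  { intros x Hx. apply exp_lt_inv. rewrite <- Hexpc in Hx.
    now apply Rmult_lt_reg_l with (Cmod z0). }
  assert (Hc0 : 0 < c). { apply Hlt. rewrite exp_0. lra. }
  set (k0 := fun w => (l * (z0 * Cexp w) / F (a + z0 * Cexp w) - 1)%C).
  (* [k0] has no meaning to the right of [Re w = c]; composing it with [cl] extends
     it continuously to the plane, as required by [periodic_primitive] *)
  set (cl := fun w : C => (Rmin (fst w) c, snd w) : C).
  set (k := fun w => k0 (cl w)).
  assert (Hexp : forall w : C, (z0 * Cexp (cl w))%C <> 0%C /\ Cmod (z0 * Cexp (cl w)) < r0).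
  { intros w. split.
    - apply Cmult_neq_0; [auto|apply Cexp_neq_0].
    - rewrite Cmod_mult, Cmod_Cexp. apply Rle_lt_trans with (r0 / 2); [|lra].
      rewrite <- Hexpc. apply Rmult_le_compat_l; [lra|]. apply exp_le_compat, Rmin_r. }
  destruct (Hnear 1 ltac:(lra)) as [d1 [_ Hd1]].
  assert (Hk0 : forall w, exists m, cderiv k0 (cl w) m).
  { intros w. destruct (Hexp w) as [E1 E2]. destruct (Hd1 _ E1 E2) as [E3 _].
    destruct (F_hol (a + z0 * Cexp (cl w))%C) as [m Hm].
    assert (D : cderiv (fun w => z0 * Cexp w)%C (cl w) (z0 * Cexp (cl w))%C).
    { apply slope_limit_scal; [apply continuous_idC|apply cderiv_Cexp]. }
    eexists. apply slope_limit_minus; [apply continuous_idC| |apply slope_limit_const].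
    apply slope_limit_mult; [apply continuous_idC| |].
    - apply slope_limit_scal; [apply continuous_idC|exact D].
    - apply slope_limit_inv; [apply continuous_idC|exact E3|].
      apply (slope_limit_comp (T := C_UniformSpace) (fun w : C => w) (fun w => a + z0 * Cexp w)%C F);
        [apply continuous_idC| |exact Hm].
      apply slope_limit_plus; [apply slope_limit_const|exact D]. }
  assert (Hcl : forall w, fst w < c -> cl w = w).
  { intros w Hw. unfold cl. rewrite Rmin_left by lra. now destruct w. }
  destruct (periodic_primitive k c) as [J [HJ HJp]].
  - intros w. apply (continuous_comp cl k0).
    + apply continuous_pair; [|apply continuous_sndC].
      apply (continuous_comp (fun w : C => fst w) (fun s => Rmin s c));
        [apply continuous_fstC|apply continuous_Rmin_const].
    + destruct (Hk0 w) as [m Hm]. exact (cderiv_continuous _ _ _ Hm).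
  - intros w Hw. destruct (Hk0 w) as [m Hm]. exists m.
    rewrite Hcl in Hm by auto.
    apply (slope_limit_ext_loc (T := C_UniformSpace) _ k0); auto.
    + unfold k. now rewrite Hcl.
    + apply locally_C_eps. exists (c - fst w). split; [lra|]. intros v Hv.
      unfold k. rewrite Hcl; auto. pose proof (Rabs_fst_le (v - w)) as T.
      pose proof (Rle_abs (fst (v - w)%C)) as T'. simpl in T, T'. lra.
  - intros w. unfold k, k0.
    replace (cl (w + two_pi_i)%C) with (cl w + two_pi_i)%C.
    + now rewrite Cexp_period.
    + unfold cl, two_pi_i, Cplus; simpl. now rewrite !Rplus_0_r.
  - intros e He. destruct (Hnear e He) as [d [Hd H]].
    exists (Rmin c (ln (d / Cmod z0))). intros w Hw.
    pose proof (Rmin_l c (ln (d / Cmod z0))); pose proof (Rmin_r c (ln (d / Cmod z0))).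
    destruct (Hexp w) as [E1 E2]. destruct (H _ E1 E2) as [_ [_ E3]]. apply E3.
    rewrite Cmod_mult, Cmod_Cexp, Hcl by lra.
    apply Rlt_le_trans with (Cmod z0 * (d / Cmod z0)); [|right; field; lra].
    apply Rmult_lt_compat_l; auto.
    rewrite <- (exp_ln (d / Cmod z0)) by now apply Rdiv_lt_0_compat.
    apply exp_increasing. lra.
  - assert (Hkk : forall w, Cmod (k w) <= / 2).
    { intros w. destruct (Hexp w) as [E1 E2]. destruct (Hd1 _ E1 E2) as [_ [E3 _]].
      unfold k, k0. lra. }
    exists J. split.
    + intros w Hw. apply Hlt in Hw. specialize (HJ w Hw). unfold k in HJ.
      now rewrite Hcl in HJ.
    + intros w Hw. apply Hlt in Hw. assert (HPI := PI_RGT_0).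
      destruct (archimed (Rabs (snd w) / (2 * PI))) as [Hup _].
      assert (Hpos : 0 <= Rabs (snd w) / (2 * PI)).
      { apply Rdiv_le_0_compat; [apply Rabs_pos|lra]. }
      set (n := Z.to_nat (up (Rabs (snd w) / (2 * PI)))).
      assert (Hn : INR n = IZR (up (Rabs (snd w) / (2 * PI)))).
      { unfold n. rewrite INR_IZR_INZ, Z2Nat.id; auto. apply le_IZR. lra. }
      destruct (periodic_reduction J c HJp n w Hw) as [w' [H1 [H2 H3]]].
      { rewrite Hn. apply Rle_trans with (2 * PI * (Rabs (snd w) / (2 * PI))).
        - right. field. lra.
        - apply Rmult_le_compat_l; lra. }
      rewrite <- H3. rewrite <- H1. rewrite <- H1 in Hw.
      assert (M := mean_value_inequality (fun t : R => J (t * w')%C)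
        (fun t : R => k (t * w') * (1 * w'))%C 0 1 (/ 2 * Cmod w') ltac:(lra)).
      cbv beta in M.
      replace (1 * w')%C with w' in M by ring. replace (0 * w')%C with (RtoC 0) in M by ring.
      eapply Rle_trans; [apply M|].
      * intros t Ht. split.
        -- apply (slope_limit_comp (T := R_UniformSpace) RtoC (fun t : R => t * w')%C J).
           ++ apply continuous_RtoC.
           ++ eapply slope_limit_eq.
              ** apply slope_limit_mult; [apply continuous_RtoC|apply slope_limit_id|apply slope_limit_const].
              ** cbv beta. ring.
           ++ apply HJ. simpl. rewrite Rmult_0_l, Rminus_0_r.
              destruct (Rle_lt_dec (fst w') 0); nra.
        -- rewrite Cmod_mult. apply Rmult_le_compat_r; [apply Cmod_ge_0|]. apply Hkk.
      * rewrite Rminus_0_r, Rmult_1_r. apply Rmult_le_compat_l; [lra|].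
        eapply Rle_trans; [apply Cmod_le_sum|lra].
Qed.

(** When [Re l >= 0] the real part of [w + J w] does not decrease along
    trajectories, whereas it would have to tend to minus infinity if the
    trajectory tended to [a]. *)
Lemma trajectory_bounded_away : 0 <= fst l ->
  exists r, 0 < r /\ forall z0 : C, z0 <> 0%C -> Cmod z0 < r ->
  exists eta, 0 < eta /\ forall f s t, s <= t -> f s = (a + z0)%C ->
    trajectory F f s t ->
    (forall u, s <= u <= t -> f u <> a /\ Cmod (f u - a) < r) ->
    eta <= Cmod (f t - a).
Proof.
  intros Hl. destruct log_rectification as [r [Hr H]].
  destruct near_simple_zero as [r1 [Hr1 Hnear]].
  destruct (Hnear 1 ltac:(lra)) as [d1 [_ Hd1]].
  pose proof (Rmin_l r r1) as Er. pose proof (Rmin_r r r1) as Er1.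
  exists (Rmin r r1). split; [now apply Rmin_pos|]. intros z0 Hz0 Hz0r.
  destruct (H z0 Hz0) as [J [HJ HJb]]; [lra|].
  assert (Hz0p : 0 < Cmod z0) by now apply Cmod_gt_0.
  exists (Cmod z0 * exp (- (2 * PI))).
  split; [apply Rmult_lt_0_compat; [auto|apply exp_pos]|].
  intros f s t Hst Hfs Hf Hfr.
  (* [W] is a logarithm of [(f - a) / z0] along the trajectory, obtained by
     integrating the logarithmic derivative; outside [s, t] the trajectory is frozen
     to have a continuous integrand on the whole line *)
  set (cl := clamp s t). set (h := fun u => (f (cl u) - a)%C).
  assert (Hclb : forall u, s <= cl u <= t) by (intros; now apply clamp_between).
  assert (Hcl : forall u, s <= u <= t -> cl u = u) by (intros; now apply clamp_id).
  assert (Hh0 : forall u, h u <> 0%C).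
  { intros u E. destruct (Hfr (cl u) (Hclb u)) as [E1 _]. apply E1.
    replace (f (cl u)) with (h u + a)%C by (unfold h; ring). rewrite E. ring. }
  set (g := fun u => (F (f (cl u)) / h u)%C).
  assert (Cfcl : forall u, continuous (fun u => f (cl u)) u).
  { intros u. apply (continuous_comp cl f); [apply continuous_clamp|].
    eapply vderiv_continuous. apply Hf. apply Hclb. }
  assert (Cg : forall u, continuous g u).
  { intros u. apply continuous_Cmult.
    - apply (continuous_comp (fun u => f (cl u)) F); auto.
      destruct (F_hol (f (cl u))) as [m Hm]. exact (cderiv_continuous _ _ _ Hm).
    - apply continuous_Cinv; auto.
      apply continuous_Cminus; auto using continuous_const. }
  set (W := fun u => CInt g s u).
  assert (HW : forall u, vderiv W u (g u)) by (intros; now apply CInt_vderiv).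
  assert (HW0 : W s = 0%C) by apply CInt_point.
  clearbody W.
  assert (Hlog : forall u, s <= u <= t -> (f u - a = z0 * Cexp (W u))%C).
  { intros u Hu.
    assert (M := mean_value_inequality (fun v => (f v - a) * / Cexp (W v))%C
      (fun _ => RtoC 0) s u 0 (proj1 Hu)). cbv beta in M.
    assert (E : ((f u - a) * / Cexp (W u) - (f s - a) * / Cexp (W s) = 0)%C).
    { apply Cmod_eq_0, Rle_antisym; [|apply Cmod_ge_0].
      eapply Rle_trans; [apply M|lra]. intros v Hv. split; [|rewrite Cmod_0; lra].
      eapply slope_limit_eq.
      - apply slope_limit_mult; [apply continuous_RtoC| |].
        + apply slope_limit_minus; [apply continuous_RtoC|apply Hf; lra|apply slope_limit_const].
        + apply slope_limit_inv; [apply continuous_RtoC|apply Cexp_neq_0|].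
          apply (slope_limit_comp (T := R_UniformSpace) RtoC W Cexp);
            [apply continuous_RtoC|apply HW|apply cderiv_Cexp].
      - cbv beta. specialize (Hh0 v). unfold g, h in *. rewrite Hcl in * by lra.
        field. split; auto using Cexp_neq_0. }
    rewrite HW0, Cexp_0, Hfs in E.
    replace (f u - a)%C with (((f u - a) * / Cexp (W u) - (a + z0 - a) * / 1
       + z0) * Cexp (W u))%C.
    - rewrite E. ring.
    - field. apply Cexp_neq_0. }
  assert (Hin : forall u, s <= u <= t -> Cmod z0 * exp (fst (W u)) = Cmod (f u - a)).
  { intros u Hu. now rewrite (Hlog u Hu), Cmod_mult, Cmod_Cexp. }
  assert (HV : forall u, s <= u <= t -> vderiv (fun u => W u + J (W u))%C u l).
  { intros u Hu. destruct (Hfr u Hu) as [_ E2].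
    eapply slope_limit_eq.
    - apply slope_limit_plus; [apply HW|].
      apply (slope_limit_comp (T := R_UniformSpace) RtoC W J);
        [apply continuous_RtoC|apply HW|].
      apply HJ. rewrite Hin by auto. lra.
    - rewrite <- Hlog by auto. specialize (Hh0 u).
      unfold g, h in *. rewrite Hcl in * by auto.
      destruct (Hd1 (f u - a)%C Hh0) as [E3 _]; [lra|].
      replace (a + (f u - a))%C with (f u) in * by ring. field. auto. }
  assert (Hmono : fst (J 0%C) <= fst (W t + J (W t))%C).
  { replace (J 0%C) with (W s + J (W s))%C by (rewrite HW0; ring).
    assert (K := derive_le_increment (fun u => - fst (W u + J (W u))%C) (fun _ => - fst l) s t 0 Hst).
    cbv beta in K. assert (- fst (W t + J (W t))%C - - fst (W s + J (W s))%C <= 0 * (t - s)); [|lra].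
    apply K. intros u Hu. split; [|lra].
    apply (is_derive_opp (V := R_NormedModule)). now apply (proj1 (vderiv_is_derive _ _ _ (HV u Hu))). }
  assert (Ht : s <= t <= t) by lra.
  rewrite <- Hin by auto.
  apply Rmult_le_compat_l; [lra|].
  assert (Hb : Cmod (J (W t) - J 0%C) <= / 2 * (Rabs (fst (W t)) + 2 * PI)).
  { apply HJb. rewrite Hin by auto. destruct (Hfr t Ht). lra. }
  pose proof (Rabs_fst_le (J (W t) - J 0%C)) as Hr'.
  pose proof (Rle_abs (fst (J (W t) - J 0%C)%C)) as Hr''.
  assert (HPI := PI_RGT_0).
  assert (Hx : - (2 * PI) <= fst (W t)).
  { simpl in Hmono, Hr', Hr''. apply Rnot_lt_le. intros Hneg.
    rewrite (Rabs_left (fst (W t))) in Hb by lra. lra. }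
  now apply exp_le_compat.
Qed.

End Multiplier.

(** * The basin of an attracting zero *)

Lemma solution_trajectory F x alpha omega phi s t :
  solution F x alpha omega phi -> open_interval alpha omega s -> open_interval alpha omega t ->
  trajectory F phi s t.
Proof.
  intros [_ [_ H]] [Hs _] [_ Ht] u Hu. apply is_derive_C_R. apply H. split.
  - eapply Rbar_lt_le_trans; [exact Hs|]. simpl. lra.
  - eapply Rbar_le_lt_trans; [|exact Ht]. simpl. lra.
Qed.

(** An elementary form of the convergence, the same for finite and infinite right
    endpoints. *)
Lemma tends_forward_eventually alpha omega (phi : R -> C) (a : C) e :
  open_interval alpha omega 0 ->
  filterlim phi (within (open_interval alpha omega) (Rbar_locally omega)) (locally a) ->
  0 < e -> exists t0, 0 <= t0 /\ open_interval alpha omega t0 /\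
    forall t, t0 <= t -> open_interval alpha omega t -> Cmod (phi t - a) < e.
Proof.
  intros [H1 H2] Hl He.
  assert (Hb : Rbar_locally omega (fun t => open_interval alpha omega t -> Cmod (phi t - a) < e)).
  { apply (Hl (fun z => Cmod (z - a) < e)). apply locally_C_eps. now exists e. }
  assert (Hpos : forall t, 0 <= t -> Rbar_lt alpha t).
  { intros t Ht. eapply Rbar_lt_le_trans; [exact H1|exact Ht]. }
  destruct omega as [w| |]; simpl in H2; try tauto.
  - apply locally_R_eps in Hb. destruct Hb as [d [Hd Hb]].
    pose proof (Rmax_l 0 (w - d / 2)). pose proof (Rmax_r 0 (w - d / 2)).
    assert (Rmax 0 (w - d / 2) < w) by (apply Rmax_lub_lt; lra).
    exists (Rmax 0 (w - d / 2)). repeat split; auto.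
    intros t Ht [K1 K2]. simpl in K2. apply Hb; [|now split].
    apply Rabs_def1; lra.
  - destruct Hb as [M Hb].
    pose proof (Rmax_l 0 (M + 1)). pose proof (Rmax_r 0 (M + 1)).
    exists (Rmax 0 (M + 1)). repeat split; auto.
    intros t Ht K. apply Hb; auto. lra.
Qed.

Section Basin.
Variable F : C -> C.
Hypothesis F_hol : forall z, exists l, cderiv F z l.
Variables (a l : C).
Hypothesis F_a : F a = 0%C.
Hypothesis F_l : cderiv F a l.

(** It suffices to follow a single orbit other than [a] that tends to [a]. *)
Lemma attracting_multiplier : l <> 0%C -> attracting F a -> fst l < 0.
Proof.
  intros Hl0 Hatt. apply Rnot_le_lt. intros Hl.
  destruct (trajectory_bounded_away F F_hol a l F_a F_l Hl0 Hl) as [r [Hr H]].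
  apply locally_C_eps in Hatt. destruct Hatt as [d [Hd Hatt]].
  set (x := (a + (d / 2)%R)%C).
  assert (Hxd : Cmod (x - a) = d / 2).
  { unfold x. replace (a + (d / 2)%R - a)%C with (RtoC (d / 2)) by ring.
    rewrite Cmod_R, Rabs_pos_eq; lra. }
  assert (Hxa : x <> a).
  { intros E. rewrite E in Hxd. replace (a - a)%C with (RtoC 0) in Hxd by ring.
    rewrite Cmod_0 in Hxd. lra. }
  destruct (Hatt x) as [alpha [omega [phi [[Hsol _] Hlim]]]]; [lra|].
  pose proof Hsol as [H0 [Hphi0 _]].
  destruct (tends_forward_eventually _ _ _ _ r H0 Hlim Hr) as [t0 [Ht0 [Ht0i Hnear]]].
  assert (Hne : forall t, 0 <= t -> open_interval alpha omega t -> phi t <> a).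
  { intros t Ht Hti. apply (trajectory_neq_equilibrium F F_hol a F_a phi 0 t); auto.
    - now apply solution_trajectory with x alpha omega.
    - now rewrite Hphi0. }
  destruct (H (phi t0 - a)%C) as [eta [Heta K]].
  - intros E. apply (Hne t0); auto.
    replace (phi t0) with ((phi t0 - a) + a)%C by ring. rewrite E. ring.
  - apply Hnear; auto. lra.
  - destruct (tends_forward_eventually _ _ _ _ eta H0 Hlim Heta) as [t1 [Ht1 [Ht1i Hnear1]]].
    assert (Hm : open_interval alpha omega (Rmax t0 t1)) by (now apply Rmax_case).
    pose proof (Rmax_l t0 t1). pose proof (Rmax_r t0 t1).
    apply (Rlt_irrefl eta). eapply Rle_lt_trans; [|apply (Hnear1 (Rmax t0 t1)); auto].
    apply (K phi t0); auto.
    + ring.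
    + now apply solution_trajectory with x alpha omega.
    + intros u Hu.
      assert (Hui : open_interval alpha omega u).
      { destruct Ht0i as [i1 _], Hm as [_ i2]. split.
        - eapply Rbar_lt_le_trans; [exact i1|simpl; lra].
        - eapply Rbar_le_lt_trans; [|exact i2]. simpl; lra. }
      split; [apply Hne; auto; lra|apply Hnear; auto; lra].
Qed.

Hypothesis l_neg : fst l < 0.

(** The right endpoint is infinite because an orbit tending to an equilibrium does
    not reach it in finite time; see [w_plus_attracted]. *)
Definition attracted (x : C) (alpha : Rbar) (phi : R -> C) : Prop :=
  maximal_solution F x alpha p_infty phi /\
  forall e, 0 < e -> exists t0, 0 <= t0 /\ forall t, t0 <= t -> Cmod (phi t - a) < e.

Lemma constant_solution_maximal : maximal_solution F a m_infty p_infty (fun _ => a).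
Proof.
  split.
  - split; [split; exact I|]. split; auto. intros t _. apply is_derive_C_R.
    apply (trajectory_const F a t t); auto. lra.
  - intros alpha' omega' psi _. split; [exact I|]. destruct omega'; exact I.
Qed.

Lemma attracted_equilibrium : attracted a m_infty (fun _ => a).
Proof.
  split; [apply constant_solution_maximal|]. intros e He. exists 0. split; [lra|].
  intros t _. replace (a - a)%C with (RtoC 0) by ring. now rewrite Cmod_0.
Qed.

(** Once some time of the given sequence brings the orbit into the trapping
    disc, the whole rest of the orbit follows the sequence to [a]. *)
Lemma w_plus_attracted x : w_plus F x a -> exists alpha phi, attracted x alpha phi.
Proof.
  intros [alpha [omega [phi [Hmax [t [Hti [Htl Hphi]]]]]]].
  pose proof Hmax as [Hsol Hmax']. pose proof Hsol as [H0 [Hphi0 _]].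
  destruct (trapping F a l F_a F_l l_neg) as [r [Hr Htrap]].
  assert (Hev : forall e N, 0 < e -> exists n, (N <= n)%nat /\ Cmod (phi (t n) - a) < e).
  { intros e N He. apply (proj1 (filterlim_C eventually _ _)) with (e := e) in Hphi; auto.
    destruct Hphi as [M HM]. exists (max N M). split; [apply Nat.le_max_l|].
    apply HM, Nat.le_max_r. }
  assert (Hge0 : exists N, forall n, (N <= n)%nat -> 0 <= t n).
  { destruct omega as [w| |]; simpl in *.
    - destruct H0 as [_ H0]. simpl in H0.
      apply is_lim_seq_spec in Htl. destruct (Htl (mkposreal w H0)) as [N HN].
      exists N. intros n Hn. specialize (HN n Hn). simpl in HN.
      apply Rabs_def2 in HN. lra.
    - apply is_lim_seq_spec in Htl. destruct (Htl 0) as [N HN].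
      exists N. intros n Hn. specialize (HN n Hn). lra.
    - destruct H0 as [_ H0]. destruct H0. }
  destruct Hge0 as [N0 HN0].
  destruct omega as [w| |].
  (* a finite right endpoint is impossible: backward in time, distances to [a]
     grow at most exponentially, so the orbit stays away from [a] in finite time *)
  - exfalso. simpl in *.
    destruct (Hev (r) N0 Hr) as [n [Hn Hnr]].
    assert (Htn : t n < w) by apply (Hti n).
    assert (Hne : phi (t n) <> a).
    { apply (trajectory_neq_equilibrium F F_hol a F_a phi 0); auto.
      - apply solution_trajectory with x alpha (Finite w); auto.
      - rewrite Hphi0. intros E.
        destruct (Hmax' m_infty p_infty (fun _ => a)) as [_ K].
        + rewrite E. apply constant_solution_maximal.
        + exact K. }
    assert (Hpos : 0 < Cmod (phi (t n) - a)).
    { apply Cmod_gt_0. intros E. apply Hne.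
      replace (phi (t n)) with ((phi (t n) - a) + a)%C by ring. rewrite E. ring. }
    destruct (entire_lipschitz F (Cmod a + r) F_hol) as [M [HM HL]].
    pose proof (exp_pos (M * (w - t n))) as Hexp.
    set (eta := Cmod (phi (t n) - a) / exp (M * (w - t n))).
    assert (Heta : 0 < eta) by now apply Rdiv_lt_0_compat.
    apply is_lim_seq_spec in Htl.
    assert (Hw : 0 < w - t n) by lra.
    destruct (Htl (mkposreal _ Hw)) as [N1 HN1]. simpl in HN1.
    destruct (Hev eta N1 Heta) as [m [Hm Hmr]]. specialize (HN1 m Hm).
    apply Rabs_def2 in HN1.
    assert (Htm : t m < w) by apply (Hti m).
    assert (Htr : trajectory F phi (t n) (t m))
      by (apply solution_trajectory with x alpha (Finite w); auto).
    destruct (trajectories_diverge F phi (fun _ => a) (t n) (t m) M) as [_ K]; auto; try lra.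
    + now apply (trajectory_const F).
    + intros u Hu. apply HL.
      * replace (phi u) with (a + (phi u - a))%C by ring.
        eapply Rle_trans; [apply Cmod_triangle|]. apply Rplus_le_compat_l.
        eapply Rle_trans; [apply (Htrap phi (t n) u); auto|lra]; try lra.
        apply trajectory_sub with (t n) (t m); auto; lra.
      * lra.
    + assert (K2 : Cmod (phi (t m) - a) * exp (M * (t m - t n)) < eta * exp (M * (w - t n))).
      { apply Rle_lt_trans with (Cmod (phi (t m) - a) * exp (M * (w - t n))).
        - apply Rmult_le_compat_l; [apply Cmod_ge_0|]. apply exp_le_compat.
          apply Rmult_le_compat_l; lra.
        - now apply Rmult_lt_compat_r. }
      replace (eta * exp (M * (w - t n))) with (Cmod (phi (t n) - a)) in K2
        by (unfold eta; field; lra). lra.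
  - exists alpha, phi. split; auto. intros e He.
    destruct (Hev (Rmin r e) N0) as [n [Hn Hnr]]; [now apply Rmin_pos|].
    pose proof (Rmin_l r e). pose proof (Rmin_r r e).
    exists (t n). split; auto. intros s Hs.
    eapply Rle_lt_trans; [apply (Htrap phi (t n) s); auto|]; try lra.
    apply solution_trajectory with x alpha p_infty; auto.
    split; [|exact I]. eapply Rbar_lt_le_trans; [apply (Hti n)|exact Hs].
  - destruct H0 as [_ H0]. destruct H0.
Qed.

Lemma attracted_interval x alpha phi t :
  attracted x alpha phi -> 0 <= t -> open_interval alpha p_infty t.
Proof.
  intros [[[[H _] _] _] _] Ht. split; [|exact I].
  eapply Rbar_lt_le_trans; [exact H|exact Ht].
Qed.

Lemma attracted_trajectory x alpha phi s t :
  attracted x alpha phi -> 0 <= s -> s <= t -> trajectory F phi s t.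
Proof.
  intros H Hs Ht. apply solution_trajectory with x alpha p_infty.
  - apply H.
  - eapply attracted_interval; eauto.
  - eapply attracted_interval; eauto. lra.
Qed.

Lemma attracted_w_plus x alpha phi : attracted x alpha phi ->
  forall y, w_plus F x y <-> y = a.
Proof.
  intros Hatt y. pose proof Hatt as [Hmax Hlim]. split.
  - intros [alpha' [omega' [psi [Hmax' [t [Hti [Htl Hpsi]]]]]]].
    assert (E : omega' = p_infty).
    { destruct Hmax as [Hsol _], Hmax' as [_ Hm']. destruct (Hm' _ _ _ Hsol) as [_ K].
      destruct omega'; simpl in K; tauto. }
    subst omega'.
    assert (Heq : forall s, 0 <= s -> psi s = phi s).
    { intros s Hs. apply (trajectory_unique_forward F F_hol psi phi 0 s); auto.
      - destruct Hmax' as [Hsol' _]. pose proof Hsol' as [[K _] _].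
        apply solution_trajectory with x alpha' p_infty; auto.
        + split; [auto|exact I].
        + split; [|exact I]. eapply Rbar_lt_le_trans; [exact K|exact Hs].
      - eapply attracted_trajectory; eauto. lra.
      - destruct Hmax as [[_ [E1 _]] _], Hmax' as [[_ [E2 _]] _]. congruence. }
    assert (Z : (y - a = 0)%C).
    { apply Cmod_eq_0, Rle_antisym; [|apply Cmod_ge_0].
      apply le_epsilon. intros e He. rewrite Rplus_0_l.
      assert (He2 : 0 < e / 2) by lra.
      destruct (Hlim _ He2) as [t0 [Ht0 H1]].
      apply is_lim_seq_spec in Htl. destruct (Htl t0) as [N HN].
      apply (proj1 (filterlim_C eventually _ _)) with (e := e / 2) in Hpsi; auto.
      destruct Hpsi as [M HM].
      specialize (HN (max N M) (Nat.le_max_l _ _)).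
      specialize (HM (max N M) (Nat.le_max_r _ _)).
      rewrite Heq in HM by lra. specialize (H1 (t (max N M)) ltac:(lra)).
      rewrite Cmod_sub_sym in HM.
      pose proof (Cmod_triangle3 y (phi (t (max N M))) a). lra. }
    replace y with ((y - a) + a)%C by ring. rewrite Z. ring.
  - intros ->. exists alpha, p_infty, phi. split; auto. exists INR. repeat split.
    + eapply attracted_interval; [exact Hatt|apply pos_INR].
    + apply is_lim_seq_INR.
    + apply (filterlim_C eventually). intros e He.
      destruct (Hlim e He) as [t0 [_ H1]].
      assert (HN : exists N : nat, t0 <= INR N).
      { destruct (INR_unbounded t0) as [N HN]. exists N. lra. }
      destruct HN as [N HN]. exists N. intros n Hn. apply H1.
      apply le_INR in Hn. lra.
Qed.

Lemma solution_shift x alpha omega phi s : solution F x alpha omega phi ->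
  open_interval alpha omega s ->
  solution F (phi s) (Rbar_plus alpha (- s)) (Rbar_plus omega (- s)) (fun t => phi (s + t)).
Proof.
  intros [H0 [Hx Hd]] Hs.
  assert (Hin : forall t, open_interval (Rbar_plus alpha (- s)) (Rbar_plus omega (- s)) t ->
    open_interval alpha omega (s + t)).
  { intros t [K1 K2]. split.
    - destruct alpha; simpl in *; auto; try lra.
    - destruct omega; simpl in *; auto; try lra. }
  split; [|split].
  - destruct Hs as [K1 K2]. split.
    + destruct alpha; simpl in *; auto; lra.
    + destruct omega; simpl in *; auto; lra.
  - now rewrite Rplus_0_r.
  - intros t Ht.
    specialize (Hd (s + t) (Hin t Ht)). apply is_derive_C_R. apply is_derive_C_R in Hd.
    destruct Hd as [q [Hq [Hq0 E]]]. exists (fun u => q (s + u)). repeat split; auto.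
    + apply (continuous_comp (fun u => s + u) q); auto.
      apply (continuous_plus (V := R_NormedModule)); [apply continuous_const|apply continuous_id].
    + intros u. rewrite (E (s + u)). rewrite !RtoC_plus. ring.
Qed.

(** Maximality of the shifted trajectory concerns the left endpoint only. *)
Lemma attracted_shift x alpha phi s : attracted x alpha phi -> 0 <= s ->
  attracted (phi s) (Rbar_plus alpha (- s)) (fun t => phi (s + t)).
Proof.
  intros Hatt Hs. pose proof Hatt as [[Hsol Hmax] Hlim]. split; [split|].
  - change p_infty with (Rbar_plus p_infty (- s)). apply solution_shift with x; auto.
    eapply attracted_interval; eauto.
  - intros alpha' omega' psi Hpsi. split; [|destruct omega'; exact I].
    assert (Ha : Rbar_lt alpha 0) by apply Hsol.
    (* a solution reaching further back than time [-s] passes through [x] *)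
    destruct (classic (Rbar_lt alpha' (- s))) as [Hlt|Hge].
    + pose proof Hpsi as [[K1 K2] [K3 _]].
      assert (K4 : Rbar_lt (- s) omega').
      { eapply Rbar_le_lt_trans; [|exact K2]. simpl. lra. }
      assert (Hi : open_interval alpha' omega' (- s)) by (split; auto).
      assert (E : psi (- s) = x).
      { pose proof (solution_shift _ _ _ _ (- s) Hpsi Hi) as Hsh.
        transitivity ((fun t => psi (- s + t)) 0); [now rewrite Rplus_0_r|].
        transitivity (phi 0); [|apply Hsol].
        apply (trajectory_unique_backward F F_hol (fun t => psi (- s + t)) phi 0 s); auto.
        - eapply solution_trajectory; [exact Hsh| |].
          + apply Hsh.
          + split.
            * destruct alpha'; simpl in *; auto; lra.
            * destruct omega'; simpl in *; auto; lra.
        - eapply attracted_trajectory; eauto. lra.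
        - replace (- s + s) with 0 by ring. auto. }
      pose proof (solution_shift _ _ _ _ (- s) Hpsi Hi) as Hsh. rewrite E in Hsh.
      destruct (Hmax _ _ _ Hsh) as [K5 _].
      destruct alpha, alpha'; simpl in *; auto; try lra.
    + apply Rbar_not_lt_le in Hge. 
      destruct alpha, alpha'; simpl in *; auto; try lra.
  - intros e He. destruct (Hlim e He) as [t0 [Ht0 H]]. exists t0. split; auto.
    intros t Ht. apply H. lra.
Qed.

(** The choice is meaningful on the basin only, where [flow_spec] shows that there
    is a trajectory to choose. *)
Definition flow (x : C) : R -> C :=
  epsilon (inhabits (fun _ => a)) (fun phi => exists alpha, attracted x alpha phi).

Definition in_basin (x : C) : Prop := forall y, w_plus F x y <-> y = a.

Lemma flow_spec x : in_basin x -> exists alpha, attracted x alpha (flow x).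
Proof.
  intros H. unfold flow. apply epsilon_spec.
  destruct (w_plus_attracted x) as [alpha [phi K]].
  - now apply H.
  - now exists phi, alpha.
Qed.

Lemma flow_trajectory x s t : in_basin x -> 0 <= s -> s <= t -> trajectory F (flow x) s t.
Proof.
  intros H. destruct (flow_spec x H) as [alpha K]. now apply (attracted_trajectory x alpha).
Qed.

Lemma flow_0 x : in_basin x -> flow x 0 = x.
Proof. intros H. destruct (flow_spec x H) as [alpha [[[_ [K _]] _] _]]. exact K. Qed.

Lemma flow_in_basin x t : in_basin x -> 0 <= t -> in_basin (flow x t).
Proof.
  intros H Ht. destruct (flow_spec x H) as [alpha K].
  unfold in_basin. eapply attracted_w_plus. apply (attracted_shift x); eauto.
Qed.

Lemma equilibrium_in_basin : in_basin a.
Proof. unfold in_basin. eapply attracted_w_plus. apply attracted_equilibrium. Qed.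

(** Near [x] the approach to [a] is uniform: continuous dependence carries the
    neighbours of [x] into a small disc at one finite time, and [trapping] keeps them
    there. *)
Lemma flow_uniformly_attracted x e : in_basin x -> 0 < e ->
  exists t d, 0 <= t /\ 0 < d /\ forall y, in_basin y -> Cmod (y - x) < d ->
    forall u, t <= u -> Cmod (flow y u - a) < e.
Proof.
  intros Hx He.
  destruct (trapping F a l F_a F_l l_neg) as [r [Hr Htrap]].
  assert (Hm : 0 < Rmin r e / 2) by (pose proof (Rmin_pos r e Hr He); lra).
  pose proof (Rmin_l r e). pose proof (Rmin_r r e).
  destruct (flow_spec x Hx) as [alpha [_ Hlim]].
  destruct (Hlim _ Hm) as [t [Ht Hclose]].
  destruct (continuous_dependence F F_hol (flow x) t (Rmin r e / 2) Ht) as [d [Hd Hdep]]; auto.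
  { apply flow_trajectory; auto. lra. }
  exists t, d. repeat split; auto. intros y Hy Hyd u Hu.
  assert (Hyt : Cmod (flow y t - a) < Rmin r e).
  { pose proof (Cmod_triangle3 (flow y t) (flow x t) a).
    specialize (Hclose t (Rle_refl t)).
    assert (Cmod (flow y t - flow x t) < Rmin r e / 2); [|lra].
    apply Hdep; [apply flow_trajectory; auto; lra| |lra].
    now rewrite !flow_0. }
  eapply Rle_lt_trans; [apply (Htrap (flow y) t u); auto|]; try lra.
  now apply flow_trajectory.
Qed.

Lemma flow_jointly_continuous x t e : in_basin x -> 0 <= t -> 0 < e ->
  exists d, 0 < d /\ forall y u, in_basin y -> 0 <= u -> Cmod (y - x) < d ->
    Rabs (u - t) < d -> Cmod (flow y u - flow x t) < e.
Proof.
  intros Hx Ht He. assert (He2 : 0 < e / 2) by lra.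
  destruct (continuous_dependence F F_hol (flow x) (t + 1) (e / 2)) as [d1 [Hd1 H1]]; auto; try lra.
  { apply flow_trajectory; auto; lra. }
  assert (Hc : continuous (flow x) t).
  { apply (vderiv_continuous (flow x) t (F (flow x t))).
    apply (flow_trajectory x t t); auto; lra. }
  destruct (proj1 (continuous_RC _ _) Hc _ He2) as [d2 [Hd2 H2]].
  exists (Rmin d1 (Rmin d2 1)).
  pose proof (Rmin_l d1 (Rmin d2 1)). pose proof (Rmin_r d1 (Rmin d2 1)).
  pose proof (Rmin_l d2 1). pose proof (Rmin_r d2 1).
  split; [repeat apply Rmin_pos; lra|]. intros y u Hy Hu Hyx Hut.
  assert (K : u <= t + 1) by (pose proof (Rle_abs (u - t)); lra).
  pose proof (Cmod_triangle3 (flow y u) (flow x u) (flow x t)).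
  assert (Cmod (flow y u - flow x u) < e / 2).
  { apply H1; [apply flow_trajectory; auto; lra| |lra]. rewrite !flow_0 by auto. lra. }
  assert (Cmod (flow x u - flow x t) < e / 2) by (apply H2; lra). lra.
Qed.

(** Time [s / (1 - s)] sweeps the whole forward orbit as [s] runs through [0, 1),
    which contracts the basin to [a] within itself. *)
Definition contraction (s : R) (x : C) : C :=
  if Rlt_dec s 1 then flow x (s / (1 - s)) else a.

Lemma contraction_time s : 0 <= s < 1 -> 0 <= s / (1 - s).
Proof. intros H. apply Rdiv_le_0_compat; lra. Qed.

Lemma contraction_in_basin s x : 0 <= s -> in_basin x -> in_basin (contraction s x).
Proof.
  intros Hs Hx. unfold contraction. destruct (Rlt_dec s 1) as [h|h].
  - apply flow_in_basin; auto. apply contraction_time; lra.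
  - apply equilibrium_in_basin.
Qed.

Lemma contraction_0 x : in_basin x -> contraction 0 x = x.
Proof.
  intros Hx. unfold contraction. destruct (Rlt_dec 0 1) as [h|h]; [|lra].
  replace (0 / (1 - 0)) with 0 by field. now apply flow_0.
Qed.

Lemma contraction_1 x : contraction 1 x = a.
Proof. unfold contraction. destruct (Rlt_dec 1 1) as [h|h]; [lra|auto]. Qed.

Lemma contraction_continuous s x e : 0 <= s <= 1 -> in_basin x -> 0 < e ->
  exists d, 0 < d /\ forall s' y, 0 <= s' <= 1 -> in_basin y -> Rabs (s' - s) < d ->
    Cmod (y - x) < d -> Cmod (contraction s' y - contraction s x) < e.
Proof.
  intros Hs Hx He. destruct (Rlt_dec s 1) as [h|h].
  - destruct (flow_jointly_continuous x (s / (1 - s)) e Hx (contraction_time s ltac:(lra)) He)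
      as [d [Hd H]].
    assert (Hc : continuous (fun v => v / (1 - v)) s).
    { apply (ex_derive_continuous (V := R_NormedModule)). auto_derive. lra. }
    apply filterlim_locally with (eps := mkposreal d Hd) in Hc.
    apply locally_R_eps in Hc. destruct Hc as [d' [Hd' Hc]].
    exists (Rmin d (Rmin d' (1 - s))).
    pose proof (Rmin_l d (Rmin d' (1 - s))). pose proof (Rmin_r d (Rmin d' (1 - s))).
    pose proof (Rmin_l d' (1 - s)). pose proof (Rmin_r d' (1 - s)).
    split; [repeat apply Rmin_pos; lra|]. intros s' y Hs' Hy Hss Hyx.
    pose proof (Rle_abs (s' - s)).
    unfold contraction. destruct (Rlt_dec s' 1) as [h1|h1]; [|lra].
    destruct (Rlt_dec s 1) as [h2|h2]; [|lra].
    apply H; auto.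
    + apply contraction_time. lra.
    + lra.
    + apply Hc. lra.
  - assert (s = 1) by lra. subst s.
    destruct (flow_uniformly_attracted x e Hx He) as [t [d [Ht [Hd H]]]].
    assert (Hp : 0 < / (t + 1)) by (apply Rinv_0_lt_compat; lra).
    exists (Rmin d (/ (t + 1))).
    pose proof (Rmin_l d (/ (t + 1))). pose proof (Rmin_r d (/ (t + 1))).
    split; [now apply Rmin_pos|]. intros s' y Hs' Hy Hss Hyx.
    rewrite contraction_1. unfold contraction. destruct (Rlt_dec s' 1) as [h1|h1].
    + apply H; auto; try lra.
      rewrite Rabs_left in Hss by lra.
      assert (K : (1 - s') * (t + 1) < 1).
      { apply Rmult_lt_reg_r with (/ (t + 1)); auto.
        rewrite Rmult_assoc, Rinv_r by lra. lra. }
      apply Rmult_le_reg_r with (1 - s'); [lra|].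
      unfold Rdiv. rewrite Rmult_assoc, Rinv_l by lra. lra.
    + replace (a - a)%C with (RtoC 0) by ring. now rewrite Cmod_0.
Qed.

End Basin.

(** * Contractible sets are simply connected *)

Lemma clamp_below v : v <= 0 -> clamp 0 1 v = 0.
Proof. intros H. unfold clamp. rewrite Rmin_left, Rmax_left; lra. Qed.

Lemma clamp_above v : 1 <= v -> clamp 0 1 v = 1.
Proof. intros H. unfold clamp. rewrite Rmin_right, Rmax_right; lra. Qed.

Lemma continuous_clamp_extension (g : R -> C) (t : R) : continuous_on unit_interval g ->
  continuous (fun u => g (clamp 0 1 u)) t.
Proof.
  intros Hg. assert (H1 := clamp_between 0 1 t ltac:(lra)).
  apply (filterlim_comp _ _ _ (clamp 0 1) g (locally t)
    (within unit_interval (locally (clamp 0 1 t)))); [|apply Hg, H1].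
  intros P HP. pose proof (continuous_clamp 0 1 t _ HP) as K.
  revert K. unfold filtermap. apply filter_imp. intros u Hu. apply Hu.
  apply clamp_between. lra.
Qed.

Lemma continuous_continuous_on {T U : UniformSpace} (A : T -> Prop) (f : T -> U) :
  (forall x, continuous f x) -> continuous_on A f.
Proof.
  intros H x _. eapply filterlim_filter_le_1; [|apply H]. apply filter_le_within.
Qed.

Section Contractible.
Variables (D : C -> Prop) (a : C) (Psi : R -> C -> C).
Hypothesis Psi_in : forall s x, 0 <= s <= 1 -> D x -> D (Psi s x).
Hypothesis Psi_0 : forall x, D x -> Psi 0 x = x.
Hypothesis Psi_1 : forall x, D x -> Psi 1 x = a.
Hypothesis Psi_cont : forall s x e, 0 <= s <= 1 -> D x -> 0 < e ->
  exists d, 0 < d /\ forall s' y, 0 <= s' <= 1 -> D y -> Rabs (s' - s) < d ->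
    Cmod (y - x) < d -> Cmod (Psi s' y - Psi s x) < e.

Lemma continuous_Psi_comp {T : UniformSpace} (s : T -> R) (p : T -> C) (u : T) :
  continuous s u -> continuous p u -> (forall v, D (p v)) ->
  continuous (fun v => Psi (clamp 0 1 (s v)) (p v)) u.
Proof.
  intros Hs Hp HD. apply continuous_C. intros e He.
  destruct (Psi_cont (clamp 0 1 (s u)) (p u) e) as [d [Hd H]]; auto.
  { apply clamp_between; lra. }
  assert (Hc : continuous (fun v => clamp 0 1 (s v)) u).
  { apply (continuous_comp s (clamp 0 1)); auto. apply continuous_clamp. }
  apply filterlim_locally with (eps := mkposreal d Hd) in Hc.
  apply continuous_C with (e := d) in Hp; auto.
  generalize (filter_and _ _ Hc Hp). apply filter_imp. intros v [H1 H2].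
  apply H; auto. apply clamp_between; lra.
Qed.

Lemma Psi_clamp_in s x : D x -> D (Psi (clamp 0 1 s) x).
Proof. intros H. apply Psi_in; auto. apply clamp_between; lra. Qed.

(** Both halves pass through [a], so they are glued as a sum minus [a]: on each half
    one summand is constantly [a]. In this form continuity is evident. *)
Lemma contractible_path_connected : path_connected D.
Proof.
  intros x y Hx Hy.
  set (g := fun t => (Psi (clamp 0 1 (2 * t)) x + Psi (clamp 0 1 (2 - 2 * t)) y - a)%C).
  assert (H1 : forall t, t <= / 2 -> g t = Psi (clamp 0 1 (2 * t)) x).
  { intros t Ht. unfold g. rewrite (clamp_above (2 - 2 * t)), Psi_1 by (auto; lra). ring. }
  assert (H2 : forall t, / 2 <= t -> g t = Psi (clamp 0 1 (2 - 2 * t)) y).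
  { intros t Ht. unfold g. rewrite (clamp_above (2 * t)), Psi_1 by (auto; lra). ring. }
  exists g. split; [|split; [|split]].
  - apply continuous_continuous_on. intros t.
    apply continuous_Cminus; [apply continuous_Cplus|apply continuous_const];
    apply continuous_Psi_comp; auto using continuous_const;
    apply (ex_derive_continuous (V := R_NormedModule)); auto_derive; auto.
  - intros t _. destruct (Rle_lt_dec t (/ 2)).
    + rewrite H1 by auto. now apply Psi_clamp_in.
    + rewrite H2 by lra. now apply Psi_clamp_in.
  - rewrite H1, clamp_below, Psi_0 by (auto; lra). reflexivity.
  - rewrite H2, clamp_below, Psi_0 by (auto; lra). reflexivity.
Qed.

(** The contraction moves the base point, so the free homotopy has to be corrected.
    For [s <= 1 / 2] the loop is pushed along [Psi] up to the level [2 * s], and the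
    path traced by the base point is inserted before and after it: with
    [hat t = min (3 t, 3 - 3 t)], the level at [t] is [min (hat t, 2 s)], and [par]
    runs through the loop while this level is constant. At [s = 1 / 2] the loop
    itself has shrunk to [a] and what is left, the path from [x] to [a] and back, is
    withdrawn for [s >= 1 / 2]. *)
Lemma contractible_null_homotopic (x : C) (gamma : R -> C) :
  path_in D gamma x x -> null_homotopic_in D gamma.
Proof.
  intros [Hc [HD [Hg0 Hg1]]].
  assert (Dx : D x). { rewrite <- Hg0. apply HD. unfold unit_interval; lra. }
  set (gm := fun u => gamma (clamp 0 1 u)).
  assert (Cgm : forall t, continuous gm t).
  { intros t. now apply continuous_clamp_extension. }
  assert (Dgm : forall t, D (gm t)). { intros t. apply HD. apply clamp_between. lra. }
  assert (gm_below : forall u, u <= 0 -> gm u = x).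
  { intros u Hu. unfold gm. now rewrite clamp_below. }
  assert (gm_above : forall u, 1 <= u -> gm u = x).
  { intros u Hu. unfold gm. now rewrite clamp_above. }
  set (hat := fun t => Rmin (3 * t) (3 - 3 * t)).
  set (up := fun s => clamp 0 1 (2 * s)).
  set (down := fun s => clamp 0 1 (2 - 2 * s)).
  set (par := fun s t => (3 * t - up s) / (3 - 2 * up s)).
  set (A := fun s t => Psi (clamp 0 1 (Rmin (hat t) (up s))) (gm (par s t))).
  set (B := fun s t => Psi (clamp 0 1 (Rmin (hat t) (down s))) x).
  set (M := fun t => Psi (clamp 0 1 (Rmin (hat t) 1)) x).
  (* [A] and [B] are the two stages and [M] their common value at [s = 1 / 2];
     gluing by a sum keeps the continuity evident *)
  set (H := fun p : R * R => (A (fst p) (snd p) + B (fst p) (snd p) - M (snd p))%C).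
  assert (Hup : forall s, 0 <= up s <= 1) by (intros; apply clamp_between; lra).
  assert (E1 : forall s t, s <= / 2 -> H (s, t) = A s t).
  { intros s t Hs. unfold H, B, M, down; simpl. rewrite (clamp_above (2 - 2 * s)) by lra. ring. }
  assert (E2 : forall s t, / 2 <= s -> H (s, t) = B s t).
  { intros s t Hs. unfold H; simpl.
    assert (EA : A s t = M t).
    { unfold A, M, par, up. rewrite (clamp_above (2 * s)) by lra.
      replace ((3 * t - 1) / (3 - 2 * 1)) with (3 * t - 1) by field.
      destruct (Rle_lt_dec (3 * t) 1); [rewrite gm_below by lra; auto|].
      destruct (Rle_lt_dec 2 (3 * t)); [rewrite gm_above by lra; auto|].
      rewrite (Rmin_right (hat t) 1).
      - rewrite clamp_above by lra. rewrite !Psi_1; auto.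
      - unfold hat. apply Rmin_glb; lra. }
    rewrite EA. ring. }
  assert (Hhat0 : hat 0 = 0) by (unfold hat; rewrite Rmin_left; lra).
  assert (Hhat1 : hat 1 = 0) by (unfold hat; rewrite Rmin_right; lra).
  assert (Hside : forall t s, t = 0 \/ t = 1 -> A s t = x /\ B s t = x).
  { intros t s Ht. assert (Hh : hat t = 0) by (destruct Ht; subst t; auto).
    unfold A, B. rewrite Hh.
    assert (L : forall v, clamp 0 1 (Rmin 0 v) = 0).
    { intros v. apply clamp_below, Rmin_l. }
    rewrite !L, !Psi_0 by auto. split; auto.
    pose proof (Hup s) as [U1 U2]. unfold par. destruct Ht; subst t.
    - apply gm_below. apply Rmult_le_reg_r with (3 - 2 * up s); [lra|].
      unfold Rdiv. rewrite Rmult_assoc, Rinv_l by lra. lra.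
    - apply gm_above. apply Rmult_le_reg_r with (3 - 2 * up s); [lra|].
      unfold Rdiv. rewrite Rmult_assoc, Rinv_l by lra. lra. }
  exists H. rewrite Hg0. split; [|split; [|split; [|split]]].
  - assert (Cs : forall p : R * R, continuous (fun p : R * R => fst p) p)
      by (intros; apply continuous_fst).
    assert (Ct : forall p : R * R, continuous (fun p : R * R => snd p) p)
      by (intros; apply continuous_snd).
    assert (Clift : forall (g : R -> R) (h : R * R -> R) p, (forall t, continuous g t) ->
      continuous h p -> continuous (fun p => g (h p)) p).
    { intros g h p Hg Hh. now apply (continuous_comp h g). }
    assert (Caff : forall (g : R -> R) (b c t : R), (forall v, g v = b + c * v) -> continuous g t).
    { intros g b c t Hg. apply continuous_ext with (fun v => b + c * v); auto.
      apply (ex_derive_continuous (V := R_NormedModule)). auto_derive; auto. }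
    assert (Cmin : forall (g h : R * R -> R) p, continuous g p -> continuous h p ->
      continuous (fun p => Rmin (g p) (h p)) p).
    { intros g h p Hg Hh.
      apply continuous_ext with (fun p => h p + Rmin (g p - h p) 0).
      - intros q. unfold Rmin. repeat destruct Rle_dec; lra.
      - apply (continuous_plus (V := R_NormedModule)); auto.
        apply (Clift (fun v => Rmin v 0) (fun p => g p - h p)).
        + intros. apply continuous_Rmin_const.
        + now apply (continuous_minus (V := R_NormedModule)). }
    assert (Chat : forall p : R * R, continuous (fun p : R * R => hat (snd p)) p).
    { intros p. apply Cmin.
      - apply (Clift (fun v => 3 * v)); auto. intros t.
        apply Caff with (0) (3). intros; ring.
      - apply (Clift (fun v => 3 - 3 * v)); auto. intros t.
        apply Caff with (3) (-3). intros; ring. }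
    assert (Cup : forall p : R * R, continuous (fun p : R * R => up (fst p)) p).
    { intros p. apply (Clift up); auto. intros t.
      apply (continuous_comp (fun s => 2 * s) (clamp 0 1)); [|apply continuous_clamp].
      apply Caff with (0) (2). intros; ring. }
    assert (Cdown : forall p : R * R, continuous (fun p : R * R => down (fst p)) p).
    { intros p. apply (Clift down); auto. intros t.
      apply (continuous_comp (fun s => 2 - 2 * s) (clamp 0 1)); [|apply continuous_clamp].
      apply Caff with (2) (-2). intros; ring. }
    apply continuous_continuous_on. intros p. unfold H.
    apply continuous_Cminus; [apply continuous_Cplus|];
    apply continuous_Psi_comp; auto using continuous_const.
    apply (continuous_comp (fun p : R * R => par (fst p) (snd p)) gm); auto.
    unfold par, Rdiv. apply (continuous_mult (K := R_AbsRing)).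
    + apply (continuous_minus (V := R_NormedModule)); auto.
      apply (Clift (fun v => 3 * v)); auto. intros t.
      apply Caff with (0) (3). intros; ring.
    + apply continuous_inv_comp; [destruct p as [s t]; cbn [fst]; destruct (Hup s); apply Rgt_not_eq; lra|].
      apply (Clift (fun v => 3 - 2 * v) (fun p : R * R => up (fst p))); auto. intros t.
      apply Caff with (3) (-2). intros; ring.
  - intros [s t] _. destruct (Rle_lt_dec s (/ 2)).
    + rewrite E1 by auto. now apply Psi_clamp_in.
    + rewrite E2 by lra. now apply Psi_clamp_in.
  - intros t Ht. unfold unit_interval in Ht. rewrite E1 by lra. unfold A, par, up.
    rewrite (clamp_below (2 * 0)) by lra.
    rewrite clamp_below, Psi_0 by (auto using Rmin_r).
    replace ((3 * t - 0) / (3 - 2 * 0)) with t by field.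
    unfold gm. now rewrite clamp_id.
  - intros t Ht. rewrite E2 by lra. unfold B, down.
    rewrite (clamp_below (2 - 2 * 1)) by lra.
    now rewrite clamp_below, Psi_0 by (auto using Rmin_r).
  - intros s Hs. destruct (Rle_lt_dec s (/ 2)).
    + rewrite !E1 by auto. split; apply Hside; auto.
    + rewrite !E2 by lra. split; apply Hside; auto.
Qed.

Lemma contractible_simply_connected : simply_connected D.
Proof. split; [apply contractible_path_connected|apply contractible_null_homotopic]. Qed.

End Contractible.

Lemma simply_connected_ext (D E : C -> Prop) : (forall x, D x <-> E x) ->
  simply_connected D -> simply_connected E.
Proof.
  intros HDE [H1 H2]. split.
  - intros x y Hx Hy. destruct (H1 x y) as [g [Hg1 [Hg2 Hg3]]]; try now apply HDE.
    exists g. split; [auto|]. split; [|auto]. intros t Ht. now apply HDE, Hg2.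
  - intros x g [Hg1 [Hg2 Hg3]].
    destruct (H2 x g) as [H [K1 [K2 K3]]].
    + split; [auto|]. split; [|auto]. intros t Ht. now apply HDE, Hg2.
    + exists H. split; [auto|]. split; [|auto]. intros p Hp. now apply HDE, K2.
Qed.

Lemma attracting_basin_simply_connected (F : C -> C) (a l : C) :
  (forall z, exists m, cderiv F z m) -> F a = 0%C -> cderiv F a l -> fst l < 0 ->
  simply_connected (in_basin F a).
Proof.
  intros HF Ha Hl Hneg.
  apply (contractible_simply_connected (in_basin F a) a (contraction F a)).
  - intros s x Hs. now apply (contraction_in_basin F HF a l).
  - apply (contraction_0 F HF a l); auto.
  - intros x _. apply contraction_1.
  - intros s x e. now apply (contraction_continuous F HF a l).
Qed.

(** * Time reversal *)

Definition reversed (F : C -> C) : C -> C := fun z => (- F z)%C.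

Lemma open_interval_opp alpha omega t :
  open_interval alpha omega t <-> open_interval (Rbar_opp omega) (Rbar_opp alpha) (- t).
Proof.
  unfold open_interval. destruct alpha, omega; simpl; lra.
Qed.

Lemma vderiv_opp_time (phi : R -> C) (t : R) (v : C) :
  vderiv phi (- t) v -> vderiv (fun s => phi (- s)) t (- v)%C.
Proof.
  intros [q [Hq [Hq0 E]]]. exists (fun s : R => - q (- s)%R)%C. repeat split.
  - apply continuous_Copp. apply (continuous_comp Ropp q); auto.
    apply (continuous_opp (V := R_NormedModule)). apply continuous_id.
  - now rewrite Hq0.
  - intros s. rewrite (E (- s)). rewrite !RtoC_opp. ring.
Qed.

Lemma solution_reversed F x alpha omega phi : solution F x alpha omega phi ->
  solution (reversed F) x (Rbar_opp omega) (Rbar_opp alpha) (fun t => phi (- t)).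
Proof.
  intros [H0 [Hx H]]. split; [|split].
  - rewrite <- Ropp_0. now apply open_interval_opp in H0.
  - now rewrite Ropp_0.
  - intros t Ht. apply is_derive_C_R. apply vderiv_opp_time.
    apply is_derive_C_R. apply H. apply open_interval_opp. now rewrite Ropp_involutive.
Qed.

Lemma solution_unreversed F x alpha omega phi : solution (reversed F) x alpha omega phi ->
  solution F x (Rbar_opp omega) (Rbar_opp alpha) (fun t => phi (- t)).
Proof.
  intros [H0 [Hx H]]. split; [|split].
  - rewrite <- Ropp_0. now apply open_interval_opp in H0.
  - now rewrite Ropp_0.
  - intros t Ht. apply is_derive_C_R.
    eapply slope_limit_eq.
    + apply vderiv_opp_time. apply is_derive_C_R. apply H.
      apply open_interval_opp. now rewrite Ropp_involutive.
    + unfold reversed. ring.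
Qed.

Lemma Rbar_opp_le_swap x y : Rbar_le (Rbar_opp x) y -> Rbar_le (Rbar_opp y) x.
Proof. destruct x, y; simpl; lra. Qed.

Lemma Rbar_le_opp_swap x y : Rbar_le x (Rbar_opp y) -> Rbar_le y (Rbar_opp x).
Proof. destruct x, y; simpl; lra. Qed.

Lemma maximal_solution_reversed F x alpha omega phi : maximal_solution F x alpha omega phi ->
  maximal_solution (reversed F) x (Rbar_opp omega) (Rbar_opp alpha) (fun t => phi (- t)).
Proof.
  intros [H1 H2]. split; [now apply solution_reversed|].
  intros alpha' omega' psi Hpsi. destruct (H2 _ _ _ (solution_unreversed _ _ _ _ _ Hpsi)).
  split; [now apply Rbar_opp_le_swap|now apply Rbar_le_opp_swap].
Qed.

Lemma maximal_solution_unreversed F x alpha omega phi :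
  maximal_solution (reversed F) x alpha omega phi ->
  maximal_solution F x (Rbar_opp omega) (Rbar_opp alpha) (fun t => phi (- t)).
Proof.
  intros [H1 H2]. split; [now apply solution_unreversed|].
  intros alpha' omega' psi Hpsi. destruct (H2 _ _ _ (solution_reversed _ _ _ _ _ Hpsi)).
  split; [now apply Rbar_opp_le_swap|now apply Rbar_le_opp_swap].
Qed.

Lemma w_minus_reversed F x y : w_minus F x y <-> w_plus (reversed F) x y.
Proof.
  split.
  - intros [alpha [omega [phi [Hm [t [H1 [H2 H3]]]]]]].
    exists (Rbar_opp omega), (Rbar_opp alpha), (fun t => phi (- t)).
    split; [now apply maximal_solution_reversed|]. exists (fun n => - t n).
    split; [|split].
    + intros n. now apply (proj1 (open_interval_opp alpha omega (t n))).
    + now apply (proj1 (is_lim_seq_opp t alpha)).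
    + eapply filterlim_ext; [|exact H3]. intros n. simpl. now rewrite Ropp_involutive.
  - intros [alpha [omega [phi [Hm [t [H1 [H2 H3]]]]]]].
    exists (Rbar_opp omega), (Rbar_opp alpha), (fun t => phi (- t)).
    split; [now apply maximal_solution_unreversed|]. exists (fun n => - t n).
    split; [|split].
    + intros n. now apply (proj1 (open_interval_opp alpha omega (t n))).
    + now apply (proj1 (is_lim_seq_opp t omega)).
    + eapply filterlim_ext; [|exact H3]. intros n. simpl. now rewrite Ropp_involutive.
Qed.

Lemma repelling_reversed F a : repelling F a -> attracting (reversed F) a.
Proof.
  unfold repelling, attracting. apply filter_imp.
  intros x [alpha [omega [phi [Hm Hl]]]].
  exists (Rbar_opp omega), (Rbar_opp alpha), (fun t => phi (- t)).
  split; [now apply maximal_solution_reversed|].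
  eapply filterlim_comp; [|exact Hl]. intros P HP.
  unfold filtermap, within in *.
  pose proof (filterlim_Rbar_opp (Rbar_opp alpha)) as K. rewrite Rbar_opp_involutive in K.
  specialize (K _ HP). unfold filtermap in K. revert K.
  apply filter_imp. intros t Ht Hi. apply Ht.
  apply open_interval_opp. now rewrite Ropp_involutive.
Qed.

Theorem theorem4p6 (F : C -> C) (a : C)
  (F_entire : entire F)
  (F_nonzero : exists z : C, F z <> 0%C)
  (a_node_or_focus : node_or_focus F a) :
  simply_connected (basin F a).
Proof.
  destruct a_node_or_focus as [[Ha [l [Hl Hl0]]] Htype].
  apply is_derive_C_C in Hl.
  pose proof (cderiv_of_entire F F_entire) as HF.
  assert (HF' : forall z, exists m, cderiv (reversed F) z m).
  { intros z. destruct (HF z) as [m Hm]. exists (- m)%C.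
    now apply slope_limit_opp; [apply continuous_idC|]. }
  assert (Ha' : reversed F a = 0%C) by (unfold reversed; rewrite Ha; ring).
  assert (Hl' : cderiv (reversed F) a (- l)%C)
    by now apply slope_limit_opp; [apply continuous_idC|].
  assert (Hl0' : (- l)%C <> 0%C).
  { intros E. apply Hl0. replace l with (- - l)%C by ring. rewrite E. ring. }
  assert (Hatt : attracting F a -> fst l < 0) by now apply attracting_multiplier.
  assert (Hrep : repelling F a -> 0 < fst l).
  { intros H. apply repelling_reversed in H.
    apply (attracting_multiplier _ HF' a _ Ha' Hl' Hl0') in H. simpl in H. lra. }
  destruct Htype as [H|H].
  - apply simply_connected_ext with (in_basin F a).
    + intros x. unfold basin. split; [now left|].
      intros [[_ K]|[K _]]; [exact K|]. specialize (Hatt H). specialize (Hrep K). lra.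
    + apply attracting_basin_simply_connected with l; auto.
  - apply simply_connected_ext with (in_basin (reversed F) a).
    + intros x. unfold basin, in_basin. split.
      * intros K. right. split; auto. intros y. rewrite w_minus_reversed. apply K.
      * intros [[K _]|[_ K]].
        -- specialize (Hatt K). specialize (Hrep H). lra.
        -- intros y. rewrite <- w_minus_reversed. apply K.
    + apply attracting_basin_simply_connected with (- l)%C; auto. simpl.
      specialize (Hrep H). lra.
Qed.
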